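(* There is a polynomial-time algorithm that solves OptAssign (defined in the context) to optimality (finding a feasible assignment of minimum cost, or reporting that none exists) on instances with no capacity constraints, i.e. with $S_\ell=\infty$ for every tier $\ell$.
   Context: OptAssign. An instance consists of the following data (all numbers are non-negative rationals unless said otherwise; $[m]$ denotes $\{1,\dots,m\}$). Tiers: there are $L$ storage tiers. Tier $\ell\in[L]$ has storage cost $C^s_\ell$, read cost $C^r_\ell$, read latency $B_\ell$, and capacity $S_\ell\in[0,\infty]$. There is a compute cost $C^c$ per second. For tiers $u,v$, $\Delta_{u,v}$ is the cost of changing from tier $u$ to tier $v$; $\Delta_{-1,\ell}$ is the cost of writing new data to tier $\ell$. Partitions: there are $N$ data partitions $P_1,\dots,P_N$ (of possibly different sizes). Partition $P_n$ has a span (size) $Sp(P_n)$, a projected number of accesses $\rho(P_n)$, a latency threshold $T(P_n)$, and a current tier $L(P_n)$, where $L(P_n)=-1$ if $P_n$ is newly ingested. The first $I$ partitions ($0\le I\le N$) are the already existing ones, and each existing partition $P_n$ has a current compression scheme $K(P_n)$; the remaining partitions are newly ingested. Compression: there is a finite set $[K]$ of compression options, one of which is ''no compression''. Option $k$ has compression ratio $R^k_n>0$ and decompression time $D^k_n$ on $P_n$; for ''no compression'', $R^k_n=1$ and $D^k_n=0$ for all $n$. Weights: $\alpha,\beta,\gamma\ge 0$. The problem is to find $x_{n,\ell,k}\in\{0,1\}$ ($n\in[N]$, $\ell\in[L]$, $k\in[K]$) minimizing $$\sum_{n=1}^{N}\sum_{k=1}^{K}\sum_{\ell=1}^{L}\Big[\big(\alpha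 C^s_\ell+\gamma\Delta_{L(P_n),\ell}\big)\frac{Sp(P_n)}{R^k_n}+\beta\rho(P_n)\Big(C^cD^k_n+C^r_\ell\frac{Sp(P_n)}{R^k_n}\Big)\Big]x_{n,\ell,k}$$ subject to (1) $\sum_{\ell}\sum_k x_{n,\ell,k}=1$ for all $n\in[N]$; (2) $\sum_n\sum_k \frac{Sp(P_n)}{R^k_n}x_{n,\ell,k}\le S_\ell$ for all $\ell\in[L]$; (3) $\sum_\ell\sum_k (D^k_n+B_\ell)x_{n,\ell,k}\le T(P_n)$ for all $n\in[N]$; (4) $x_{n,\ell,k}=0$ for all $n\in[I]$, $\ell\in[L]$ and $k\ne K(P_n)$. *)

(* Defs.v *)
From HB Require Import structures.
From mathcomp Require Import all_boot all_order all_algebra.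
From mathcomp Require Import constructive_ereal.

Set Implicit Arguments.
Unset Strict Implicit.
Unset Printing Implicit Defensive.

Import Order.TTheory GRing.Theory Num.Theory.

(* Deterministic multi-tape Turing machines with tape alphabet {blank, 0, 1}. *)

Definition word := seq bool.

(* [None] is the blank. *)
Definition symbol := option bool.

Variant move := MoveLeft | Stay | MoveRight.

(* A two-way infinite tape: the scanned cell, and the cells on each side of it
   listed from the nearest outwards; cells beyond either list are blank. *)
Record tape := Tape { tleft : seq symbol; thead : symbol; tright : seq symbol }.

Definition tape_of_seq (s : seq symbol) : tape :=
  Tape [::] (head None s) (behead s).

Definition blank_tape : tape := tape_of_seq [::].

Definition act_tape (a : symbol * move) (t : tape) : tape :=
  match a.2 with
  | MoveLeft => Tape (behead (tleft t)) (head None (tleft t)) (a.1 :: tright t)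
  | Stay => Tape (tleft t) a.1 (tright t)
  | MoveRight => Tape (a.1 :: tleft t) (head None (tright t)) (behead (tright t))
  end.

Fixpoint nonblank_prefix (s : seq symbol) : word :=
  if s is Some b :: s' then b :: nonblank_prefix s' else [::].

(* The word written from the scanned cell rightwards, up to the first blank. *)
Definition tape_word (t : tape) : word := nonblank_prefix (thead t :: tright t).

Record TM := MkTM {
  state : finType;
  ntapes_pred : nat;  (* one less than the number of tapes *)
  start : state;
  halting : pred state;
  delta : state -> {ffun 'I_ntapes_pred.+1 -> symbol} ->
          state * ('I_ntapes_pred.+1 -> symbol * move) }.

Record config (M : TM) := Config {
  cstate : state M;
  ctapes : 'I_(ntapes_pred M).+1 -> tape }.

(* The first tape holds the input, with the head on its first letter. *)
Definition init_config (M : TM) (w : word) : config M :=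
  Config (start M)
    (fun i => if i == ord0 then tape_of_seq (map Some w) else blank_tape).

Definition step (M : TM) (c : config M) : config M :=
  if halting (cstate c) then c else
  let r := delta (cstate c) [ffun i => thead (ctapes c i)] in
  Config r.1 (fun i => act_tape (r.2 i) (ctapes c i)).

(* On input [w], [M] halts after at most [t] steps, the last tape then holding
   [v]; halting configurations are fixed by [step]. *)
Definition outputs_within (M : TM) (w : word) (t : nat) (v : word) : Prop :=
  let c := iter t (@step M) (init_config M w) in
  halting (cstate c) /\ tape_word (ctapes c ord_max) = v.

Local Open Scope ring_scope.

(* For a tier index, [None] stands for the pseudo-tier -1 of new data. *)
Record instance := Instance {
  nL : nat;
  nN : nat;
  nI : nat;
  nK : nat;
  storage_cost : 'I_nL -> rat;                  (* C^s *)
  read_cost : 'I_nL -> rat;                     (* C^r *)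
  read_latency : 'I_nL -> rat;                  (* B *)
  capacity : 'I_nL -> \bar rat;                 (* S *)
  compute_cost : rat;                           (* C^c *)
  change_cost : option 'I_nL -> 'I_nL -> rat;   (* Delta *)
  part_span : 'I_nN -> rat;                     (* Sp *)
  accesses : 'I_nN -> rat;                      (* rho *)
  threshold : 'I_nN -> rat;                     (* T *)
  cur_tier : 'I_nN -> option 'I_nL;             (* L(P_n) *)
  cur_scheme : 'I_nN -> option 'I_nK;           (* K(P_n), if any *)
  no_compression : 'I_nK;
  comp_ratio : 'I_nN -> 'I_nK -> rat;           (* R *)
  decomp_time : 'I_nN -> 'I_nK -> rat;          (* D *)
  alpha : rat;
  beta : rat;
  gamma : rat;
  leq_nI_nN : (nI <= nN)%N;
  storage_cost_ge0 : forall l, 0 <= storage_cost l;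
  read_cost_ge0 : forall l, 0 <= read_cost l;
  read_latency_ge0 : forall l, 0 <= read_latency l;
  capacity_ge0 : forall l, (0 <= capacity l)%E;
  compute_cost_ge0 : 0 <= compute_cost;
  change_cost_ge0 : forall u l, 0 <= change_cost u l;
  part_span_ge0 : forall n, 0 <= part_span n;
  accesses_ge0 : forall n, 0 <= accesses n;
  threshold_ge0 : forall n, 0 <= threshold n;
  cur_tier_existing : forall n : 'I_nN, isSome (cur_tier n) = (n < nI)%N;
  cur_scheme_existing : forall n : 'I_nN, isSome (cur_scheme n) = (n < nI)%N;
  comp_ratio_gt0 : forall n k, 0 < comp_ratio n k;
  decomp_time_ge0 : forall n k, 0 <= decomp_time n k;
  comp_ratio_no_compression : forall n, comp_ratio n no_compression = 1;
  decomp_time_no_compression : forall n, decomp_time n no_compression = 0;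
  alpha_ge0 : 0 <= alpha;
  beta_ge0 : 0 <= beta;
  gamma_ge0 : 0 <= gamma }.

(* The 0/1 variables x_{n,l,k}. *)
Definition assignment (P : instance) := 'I_(nN P) -> 'I_(nL P) -> 'I_(nK P) -> bool.

Definition cost (P : instance) (x : assignment P) : rat :=
  \sum_n \sum_k \sum_l
    ((alpha P * storage_cost l + gamma P * change_cost (cur_tier n) l)
       * (part_span n / comp_ratio n k)
     + beta P * accesses n
       * (compute_cost P * decomp_time n k
          + read_cost l * (part_span n / comp_ratio n k)))
    * (x n l k)%:R.

Definition feasible (P : instance) (x : assignment P) : Prop :=
  [/\ forall n, (\sum_l \sum_k x n l k = 1)%N,
      forall l,
        ((\sum_n \sum_k part_span n / comp_ratio n k * (x n l k)%:R)%:E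
          <= capacity l)%E,
      forall n,
        \sum_l \sum_k (decomp_time n k + read_latency l) * (x n l k)%:R
          <= threshold n
    & forall (n : 'I_(nN P)) l k,
        (n < nI P)%N -> Some k <> cur_scheme n -> x n l k = false].

Definition optimal (P : instance) (x : assignment P) : Prop :=
  feasible x /\ forall y : assignment P, feasible y -> cost x <= cost y.

(* [None] is the report that there is no feasible assignment. *)
Definition correct_answer (P : instance) (a : option (assignment P)) : Prop :=
  if a is Some x then optimal x else forall y : assignment P, ~ feasible y.

Definition no_capacity_constraints (P : instance) : Prop :=
  forall l : 'I_(nL P), capacity l = +oo%E.

(* Encodings.  Rationals are written as reduced fractions with numerator and
   denominator in binary.  Dimensions and indices are written in unary: the data
   tables they refer to are listed entry by entry anyway. *)

Definition enc_unary (n : nat) : word := rcons (nseq n true) false.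

(* Least significant bit first, no leading zeros; 0 is the empty word. *)
Definition bits_of_nat (n : nat) : word :=
  mkseq (fun i => odd (n %/ 2 ^ i)%N) (up_log 2 n.+1).

(* Each bit is preceded by the mark 1 and the number is closed by 0. *)
Definition enc_nat (n : nat) : word :=
  rcons (flatten [seq [:: true; b] | b <- bits_of_nat n]) false.

(* Only used for non-negative rationals, so no sign is recorded. *)
Definition enc_rat (r : rat) : word :=
  enc_nat `|numq r|%N ++ enc_nat `|denq r|%N.

(* Only used for values in [0, +oo]. *)
Definition enc_erat (r : \bar rat) : word :=
  if r is r%:E%E then true :: enc_rat r else [:: false].

Definition enc_option (T : Type) (enc : T -> word) (o : option T) : word :=
  if o is Some a then true :: enc a else [:: false].

Definition enc_ord (n : nat) (i : 'I_n) : word := enc_unary i.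

Definition enc_table (n : nat) (f : 'I_n -> word) : word :=
  flatten [seq f i | i <- enum 'I_n].

Definition enc_instance (P : instance) : word :=
     enc_unary (nL P) ++ enc_unary (nN P) ++ enc_unary (nI P) ++ enc_unary (nK P)
  ++ enc_rat (alpha P) ++ enc_rat (beta P) ++ enc_rat (gamma P)
  ++ enc_rat (compute_cost P)
  ++ enc_ord (no_compression P)
  ++ enc_table (fun l : 'I_(nL P) =>
          enc_rat (storage_cost l) ++ enc_rat (read_cost l)
       ++ enc_rat (read_latency l) ++ enc_erat (capacity l))
  ++ enc_table (fun l : 'I_(nL P) => enc_rat (change_cost None l))
  ++ enc_table (fun u : 'I_(nL P) =>
       enc_table (fun l : 'I_(nL P) => enc_rat (change_cost (Some u) l)))
  ++ enc_table (fun n : 'I_(nN P) =>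
          enc_rat (part_span n) ++ enc_rat (accesses n) ++ enc_rat (threshold n)
       ++ enc_option (@enc_ord _) (cur_tier n)
       ++ enc_option (@enc_ord _) (cur_scheme n)
       ++ enc_table (fun k : 'I_(nK P) =>
            enc_rat (comp_ratio n k) ++ enc_rat (decomp_time n k))).

Definition enc_answer (P : instance) (a : option (assignment P)) : word :=
  enc_option (fun x : assignment P =>
    enc_table (fun n => enc_table (fun l => enc_table (fun k => [:: x n l k])))) a.

(* Main.v *)
(** Without capacities the partitions decouple: each one takes its cheapest
    admissible pair (tier, compression option), found by exact comparison of
    fractions in binary among the [nL * nK] pairs.

    For the machine, values are encoded as binary trees written in prefix order
    on a tape used as a stack, so that a value can be moved, copied or dropped
    by counting the subtrees still to be read.  The functions computed on such
    encodings in polynomial time contain the projections and the constants, and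
    are closed under composition, pairing, case analysis, and under folding over
    a list as soon as all intermediate accumulators have polynomial size: running
    times thus follow from size bounds. *)

(* Closure under folding is where polynomial time can fail: a step that doubles its accumulator is
   cheap, yet n rounds of it give a value of exponential size. The fold rule therefore bounds every
   accumulator reached along the list, and most uses meet it through a simpler criterion: one step
   adds an amount that depends on the input only.

   Two representations keep sizes under control. Naturals are unary, since they only hold
   dimensions, indices and loop counters, which the input writes in unary too; magnitudes are lists
   of bits. Fractions are never reduced: the cost of a pair is an expression with a fixed number of
   operations, so its numerator and denominator stay of polynomial length, and cross-multiplication
   compares them without division or gcd.

   The encodings of different types share their trees (a nonempty list with a pair, a natural with a
   list of units); constructors, conversions and case analysis then need almost no machine code, and
   only a handful of machines are built by hand. *)
From Stdlib Require Import FunctionalExtensionality.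
Require Import Defs.
From mathcomp Require Import all_boot all_order all_algebra.
From mathcomp Require Import constructive_ereal zify.

Set Implicit Arguments.
Unset Strict Implicit.
Unset Printing Implicit Defensive.

(** * Machine fragments *)

(* [fexit] is [None] while running; the boolean with which a fragment stops
   selects the continuation in [branch] and the repetition in [loop]. *)
Record frag := Frag {
  fstate : finType;
  fstart : fstate;
  fexit : fstate -> option bool;
  fdelta : fstate -> {ffun 'I_4 -> symbol} ->
           fstate * ('I_4 -> symbol * move) }.

Definition frag_TM (F : frag) : TM :=
  @MkTM (fstate F) 3 (fstart F) (fun q => isSome (fexit q)) (@fdelta F).

Definition fcfg (F : frag) (q : fstate F) (t : 'I_4 -> tape) :
  config (frag_TM F) := @Config (frag_TM F) q t.

Definition fstep (F : frag) := @step (frag_TM F).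

(** [n] is only an upper bound on the running time: a stopped configuration is a fixed point of the
    step, so bounds can be rounded up freely. *)
Definition fruns (F : frag) (q : fstate F) t n b t' :=
  exists2 q', fexit q' = Some b & iter n (@fstep F) (fcfg q t) = fcfg q' t'.

Definition idle (v : {ffun 'I_4 -> symbol}) (i : 'I_4) := (v i, Stay).

Lemma idleE (t : 'I_4 -> tape) :
  (fun i => act_tape (idle [ffun j => Defs.thead (t j)] i) (t i)) = t.
Proof.
by apply: functional_extensionality => i; rewrite /idle ffunE; case: (t i).
Qed.

Lemma fstepE F (q : fstate F) t : fstep (fcfg q t) =
  if isSome (fexit q) then fcfg q t
  else let r := fdelta q [ffun i => Defs.thead (t i)] in
       fcfg r.1 (fun i => act_tape (r.2 i) (t i)).
Proof. by []. Qed.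

Lemma fstep_exit F (q : fstate F) t b :
  fexit q = Some b -> fstep (fcfg q t) = fcfg q t.
Proof. by rewrite fstepE => ->. Qed.

Lemma iter_fstep_exit F (q : fstate F) t b n :
  fexit q = Some b -> iter n (@fstep F) (fcfg q t) = fcfg q t.
Proof. by move=> qb; elim: n => //= n ->; apply: fstep_exit qb. Qed.

Lemma fruns_mono F (q : fstate F) t n m b t' :
  n <= m -> fruns q t n b t' -> fruns q t m b t'.
Proof.
move=> lenm [q' q'b e]; exists q' => //.
by rewrite -(subnK lenm) iterD e (iter_fstep_exit _ _ q'b).
Qed.

Definition branch (F G H : frag) : frag :=
  @Frag (fstate F + (fstate G + fstate H))%type (inl (fstart F))
    (fun q => match q with
              | inl _ => None
              | inr (inl q) => fexit q
              | inr (inr q) => fexit q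
              end)
    (fun q v => match q with
      | inl q => match fexit q with
                 | None => (inl (fdelta q v).1, (fdelta q v).2)
                 | Some true => (inr (inl (fstart G)), idle v)
                 | Some false => (inr (inr (fstart H)), idle v)
                 end
      | inr (inl q) => (inr (inl (fdelta q v).1), (fdelta q v).2)
      | inr (inr q) => (inr (inr (fdelta q v).1), (fdelta q v).2)
      end).

(** Inside [branch] the exit states of [F] no longer halt, so the simulation is cut at the round
    where [F] first stops: hence some [m <= n] instead of [n]. *)
Lemma branch_first F G H n q t q' t' b :
  fexit q' = Some b -> iter n (@fstep F) (fcfg q t) = fcfg q' t' ->
  exists2 m, m <= n &
    iter m (@fstep (branch F G H)) (fcfg (inl q : fstate (branch F G H)) t)
      = fcfg (inl q' : fstate (branch F G H)) t'.
Proof.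
move=> q'b; elim: n q t => [|n IHn] q t; first by case=> -> ->; exists 0.
rewrite iterSr; case eq: (fexit q) => [c|].
  rewrite (fstep_exit _ eq) (iter_fstep_exit _ _ eq) => -[<- <-].
  by exists 0.
rewrite fstepE eq => /IHn[m lemn e]; exists m.+1 => //.
by rewrite iterSr fstepE /= eq.
Qed.

Lemma branch_true F G H n q t :
  iter n (@fstep (branch F G H)) (fcfg (inr (inl q) : fstate (branch F G H)) t)
  = let c := iter n (@fstep G) (fcfg q t) in
    fcfg (inr (inl (cstate c)) : fstate (branch F G H)) (ctapes c).
Proof.
elim: n q t => [//|n IHn] q t; rewrite !iterSr !fstepE /=.
by case: (fexit q) => [b|] /=; apply: IHn.
Qed.

Lemma branch_false F G H n q t :
  iter n (@fstep (branch F G H)) (fcfg (inr (inr q) : fstate (branch F G H)) t)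
  = let c := iter n (@fstep H) (fcfg q t) in
    fcfg (inr (inr (cstate c)) : fstate (branch F G H)) (ctapes c).
Proof.
elim: n q t => [//|n IHn] q t; rewrite !iterSr !fstepE /=.
by case: (fexit q) => [b|] /=; apply: IHn.
Qed.

(** The extra round is the jump from the exit state of [F] to the next fragment, which leaves the
    tapes as they are. *)
Lemma fruns_branch F G H t n b t' m b' t'' :
  fruns (fstart F) t n b t' ->
  fruns (fstart (if b then G else H)) t' m b' t'' ->
  fruns (fstart (branch F G H)) t (n + m).+1 b' t''.
Proof.
case=> q qb /(@branch_first F G H _ _ _ _ _ b qb)[k lekn e] runs.
apply: (@fruns_mono _ _ _ (k + m).+1); first by lia.
case: b qb runs => qb [q'' q''b' e'].
- exists (inr (inl q'')) => //.
  rewrite addnC -addnS iterD iterS e fstepE /= qb /= idleE.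
  by rewrite (branch_true F H m (fstart G) t') e'.
- exists (inr (inr q'')) => //.
  rewrite addnC -addnS iterD iterS e fstepE /= qb /= idleE.
  by rewrite (branch_false F G m (fstart H) t') e'.
Qed.

Definition loop (F : frag) : frag :=
  @Frag (fstate F) (fstart F)
    (fun q => if fexit q is Some false then Some false else None)
    (fun q v => if fexit q is None then fdelta q v else (fstart F, idle v)).

Lemma loop_body F n q t q' t' b :
  fexit q' = Some b -> iter n (@fstep F) (fcfg q t) = fcfg q' t' ->
  exists2 m, m <= n &
    iter m (@fstep (loop F)) (fcfg (q : fstate (loop F)) t)
      = fcfg (q' : fstate (loop F)) t'.
Proof.
move=> q'b; elim: n q t => [|n IHn] q t; first by case=> -> ->; exists 0.
rewrite iterSr; case eq: (fexit q) => [c|].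
  rewrite (fstep_exit _ eq) (iter_fstep_exit _ _ eq) => -[<- <-].
  by exists 0.
rewrite fstepE eq => /IHn[m lemn e]; exists m.+1 => //.
by rewrite iterSr fstepE /= eq.
Qed.

Lemma fruns_loop_exit F t n t' :
  fruns (fstart F) t n false t' ->
  fruns (fstart (loop F)) t n false t'.
Proof.
case=> q qb /(@loop_body F _ _ _ _ _ false qb)[k lekn e].
by apply: fruns_mono lekn _; exists q; rewrite /= ?qb.
Qed.

Lemma fruns_loop_next F t n t' m t'' :
  fruns (fstart F) t n true t' ->
  fruns (fstart (loop F)) t' m false t'' ->
  fruns (fstart (loop F)) t (n + m).+1 false t''.
Proof.
case=> q qb /(@loop_body F _ _ _ _ _ true qb)[k lekn e] [q'' q''b' e'].
apply: (@fruns_mono _ _ _ (k + m).+1); first by lia.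
exists q'' => //; rewrite addnC -addnS iterD iterS e fstepE /= qb /=.
by rewrite idleE e'.
Qed.

(** * One-step fragments, and tapes used as stacks *)

Definition atom (f : {ffun 'I_4 -> symbol} -> bool * ('I_4 -> symbol * move)) :=
  @Frag (option bool : finType) None id (fun _ v => (Some (f v).1, (f v).2)).

Lemma fruns_atom f t (r := f [ffun j => Defs.thead (t j)]) :
  fruns (fstart (atom f)) t 1 r.1 (fun i => act_tape (r.2 i) (t i)).
Proof. by exists (Some r.1). Qed.

(* A tape serves as a stack whose top is the scanned cell. *)
Definition is_stack (t : tape) (w : word) :=
  all (pred1 None) (tleft t) /\
  exists k, Defs.thead t :: tright t = map Some w ++ nseq k None.

Definition stacks_in (t : 'I_4 -> tape) (s : seq word) :=
  forall i : 'I_4, is_stack (t i) (nth [::] s i).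

(** A Hoare triple with a time bound. It speaks of stacks rather than tapes, so that the number of
    blanks stored beyond a stack never appears. *)
Definition ex F s n b s' := forall t, stacks_in t s ->
  exists2 t', fruns (fstart F) t n b t' & stacks_in t' s'.

Lemma ex_mono F s n m b s' : n <= m -> ex F s n b s' -> ex F s m b s'.
Proof.
by move=> lenm e t /e[t' r ?]; exists t' => //; apply: fruns_mono r.
Qed.

Lemma ex_branch F G H s n b s' m b' s'' :
  ex F s n b s' -> ex (if b then G else H) s' m b' s'' ->
  ex (branch F G H) s (n + m).+1 b' s''.
Proof.
by move=> e e' t /e[t' r /e'[t'' r' ?]]; exists t'' => //; apply: fruns_branch r r'.
Qed.

Definition seqf F G := branch F G G.

Lemma ex_seq F G s n b s' m b' s'' :
  ex F s n b s' -> ex G s' m b' s'' -> ex (seqf F G) s (n + m).+1 b' s''.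
Proof. by move=> e e'; apply: ex_branch e _; case: b. Qed.

Lemma ex_loop_exit F s n s' : ex F s n false s' -> ex (loop F) s n false s'.
Proof. by move=> e t /e[t' r ?]; exists t' => //; apply: fruns_loop_exit. Qed.

Lemma ex_loop_next F s n s' m s'' :
  ex F s n true s' -> ex (loop F) s' m false s'' ->
  ex (loop F) s (n + m).+1 false s''.
Proof.
by move=> e e' t /e[t' r /e'[t'' r' ?]]; exists t'' => //; apply: fruns_loop_next r r'.
Qed.

Definition act_on (i : nat) (a : symbol -> symbol * move)
    (v : {ffun 'I_4 -> symbol}) (j : 'I_4) :=
  if j == i :> nat then a (v j) else (v j, Stay).

Definition peek i (lab : option bool -> bool) :=
  atom (fun v => (lab (v (inord i)), idle v)).
Definition pop i (lab : option bool -> bool) :=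
  atom (fun v => (lab (v (inord i)), act_on i (fun _ => (None, MoveRight)) v)).
(** A transition writes before it moves, so making room on the left and writing the new symbol take
    two transitions. *)
Definition push i x :=
  seqf (atom (fun v => (true, act_on i (fun a => (a, MoveLeft)) v)))
       (atom (fun v => (true, act_on i (fun _ => (Some x, Stay)) v))).

Lemma is_stack_head t w : is_stack t w -> Defs.thead t = ohead w.
Proof. by case=> _ [[|k]]; case: w => [|x w] //= [->]. Qed.

Lemma ex_peek i lab s : i < 4 -> ex (peek i lab) s 1 (lab (ohead (nth [::] s i))) s.
Proof.
move=> lti t st; have := fruns_atom (fun v => (lab (v (inord i)), idle v)) t.
rewrite /= ffunE idleE.
have /is_stack_head -> := st (inord i); rewrite inordK //.
by exists t.
Qed.

Lemma ex_pop i lab s : i < 4 ->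
  ex (pop i lab) s 1 (lab (ohead (nth [::] s i)))
     (set_nth [::] s i (behead (nth [::] s i))).
Proof.
move=> lti t st.
have := fruns_atom
  (fun v => (lab (v (inord i)), act_on i (fun _ => (None, MoveRight)) v)) t.
rewrite /= ffunE.
have /is_stack_head -> := st (inord i); rewrite inordK // => r.
eexists; first exact: r.
move=> j; rewrite nth_set_nth /= /act_on; case: eqP (st j) => [->|_] stj; last first.
  by rewrite ffunE; case: (t j) stj.
case: stj => al [k e]; split; first by rewrite /= al.
case: (nth _ _ _) e => [|x w] /=.
  (* Empty stack: the head moves one blank to the right, past the stored blanks if need be, and the
     stack stays empty. *)
  case: k => //= k [_ ->]; case: k => [|k] /=; last by exists k.+1.
  by exists 1.
case=> _ ->; case: w => [|y w] /=; last by exists k.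
by case: k => [|k]; [exists 1|exists k.+1].
Qed.

Lemma ex_push i x s : i < 4 ->
  ex (push i x) s 3 true (set_nth [::] s i (x :: nth [::] s i)).
Proof.
move=> lti t st.
pose f v := (true, act_on i (fun a => (a, MoveLeft)) v).
pose g v := (true, act_on i (fun _ => (Some x, Stay)) v).
have r1 := fruns_atom f t.
have r2 := fruns_atom g (fun j => act_tape ((f [ffun j0 => Defs.thead (t j0)]).2 j) (t j)).
eexists; first exact: fruns_branch r1 r2.
move=> j; rewrite /= nth_set_nth /= /act_on.
move: (st j); have [->|ne] := eqVneq (j : nat) i => stj; last first.
  by rewrite !ffunE (negbTE ne) ?ffunE; case: (t j) stj.
case: stj => al [k e]; split => /=; last first.
  by exists k; rewrite ffunE e.
by case: (tleft _) al => [//|a l] /= /andP[].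
Qed.

(** * Trees on the stack tape *)

Inductive tree := Leaf | Node of tree & tree.

Fixpoint tree_word (t : tree) : word :=
  if t is Node a b then true :: tree_word a ++ tree_word b else [:: false].

Definition is_true_top (x : option bool) := x == Some true.
Definition yes (x : option bool) := true.
Definition no (x : option bool) := false.

Definition push_if (c : bool) i x := if c then push i x else peek i yes.

(* Tape 3 is the main stack, tapes 0 and 1 are scratch stacks, and tape 2 counts
   in unary the trees that remain to be read. *)
Definition take_tree_step (ca cb : bool) :=
  branch (peek 2 isSome)
    (branch (pop 3 is_true_top)
       (seqf (push_if ca 0 true) (seqf (push_if cb 1 true) (push 2 true)))
       (seqf (push_if ca 0 false) (seqf (push_if cb 1 false) (pop 2 yes))))
    (peek 2 no).

Definition take_tree ca cb := seqf (push 2 true) (loop (take_tree_step ca cb)).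

(** Form suited to [eapply]: executing the fragment symbolically fills in the bound, the exit and
    the stacks, which are compared with the wanted ones afterwards. *)
Lemma ex_conv F s n b s' m b' s'' :
  ex F s n b s' -> n <= m -> b = b' -> s' = s'' -> ex F s m b' s''.
Proof. by move=> e lenm <- <-; apply: ex_mono e. Qed.

Ltac ex_prim := first [exact: ex_peek | exact: ex_pop | exact: ex_push].
Ltac ex_then := first [eapply ex_seq | eapply ex_branch]; [ex_prim | rewrite /=].

Lemma ex_take_step ca cb a b c x s :
  ex (take_tree_step ca cb) [:: a; b; true :: c; x :: s] 20 true
     [:: if ca then x :: a else a; if cb then x :: b else b;
         if x then [:: true, true & c] else c; s].
Proof.
by case: x ca cb => [] [] []; rewrite /take_tree_step /push_if; 
  (eapply ex_conv; [do 4? ex_then; ex_prim | ..]).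
Qed.

(** A single tree is not a stable invariant, since reading a node leaves its two children to be
    read. The statement is thus about a forest, with its length on the counter, and goes by
    induction on the number of symbols. The scratch stacks receive the word backwards, hence
    [catrev]. *)
Lemma ex_take_trees ca cb n a b r (ts : seq tree) :
  let w := flatten (map tree_word ts) in size w = n ->
  ex (loop (take_tree_step ca cb)) [:: a; b; nseq (size ts) true; w ++ r]
     (30 * n + 5) false
     [:: if ca then catrev w a else a; if cb then catrev w b else b; [::]; r].
Proof.
elim: n a b ts => [|n IHn] a b [|t ts] //=; last 1 first.
- case: t => [|t1 t2] /= [szw].
  + have h := IHn (if ca then false :: a else a) (if cb then false :: b else b) ts szw.
    eapply ex_conv; [eapply ex_loop_next|..]; [apply: ex_take_step|exact: h|lia|by []|].
    by clear; case: ca; case: cb.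
  + have := IHn (if ca then true :: a else a) (if cb then true :: b else b) [:: t1, t2 & ts].
    rewrite /= catA => /(_ szw) h.
    eapply ex_conv; [eapply ex_loop_next|..]; [apply: ex_take_step|exact: h|lia|by []|].
    by clear; case: ca; case: cb.
- move=> _; eapply ex_conv; [apply: ex_loop_exit; do 4? ex_then; ex_prim|..] => //.
  by case: ca; case: cb.
- by case: t.
Qed.

Lemma ex_take_tree ca cb a b r t :
  ex (take_tree ca cb) [:: a; b; [::]; tree_word t ++ r]
     (30 * size (tree_word t) + 10) false
     [:: if ca then catrev (tree_word t) a else a;
         if cb then catrev (tree_word t) b else b; [::]; r].
Proof.
have := @ex_take_trees ca cb _ a b r [:: t]; rewrite /= cats0 => /(_ _ erefl) h.
by eapply ex_conv; [ex_then; exact: h|lia|..].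
Qed.

Definition dump_step i :=
  branch (peek i isSome)
    (branch (pop i is_true_top) (push 3 true) (push 3 false))
    (peek i no).

(** Scratch copies are reversed; pouring them back on the main stack reverses them again. *)
Definition dump i := loop (dump_step i).

Lemma ex_dump_fst a b r :
  ex (dump 0) [:: a; b; [::]; r] (20 * size a + 5) false
     [:: [::]; b; [::]; catrev a r].
Proof.
elim: a r => [|x a IHa] r.
  by eapply ex_conv; [apply: ex_loop_exit; ex_then; ex_prim|..].
have e : ex (dump_step 0) [:: x :: a; b; [::]; r] 8 true [:: a; b; [::]; x :: r].
  by case: x; (eapply ex_conv; [do 2 ex_then; ex_prim|..]).
by eapply ex_conv; [apply: ex_loop_next e (IHa _)|rewrite /=; lia|..].
Qed.

Lemma ex_dump_snd a b r :
  ex (dump 1) [:: a; b; [::]; r] (20 * size b + 5) false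
     [:: a; [::]; [::]; catrev b r].
Proof.
elim: b r => [|x b IHb] r.
  by eapply ex_conv; [apply: ex_loop_exit; ex_then; ex_prim|..].
have e : ex (dump_step 1) [:: a; x :: b; [::]; r] 8 true [:: a; b; [::]; x :: r].
  by case: x; (eapply ex_conv; [do 2 ex_then; ex_prim|..]).
by eapply ex_conv; [apply: ex_loop_next e (IHb _)|rewrite /=; lia|..].
Qed.

(** The arbitrary rest [r] is a frame: only the top of the main stack is affected. Scratch stacks
    and counter are empty again at the end, so such fragments can be chained. *)
Definition rewrites F (x : word) n (y : word) := forall r, exists b,
  ex F [:: [::]; [::]; [::]; x ++ r] n b [:: [::]; [::]; [::]; y ++ r].

Lemma rewrites_mono F x n m y : n <= m -> rewrites F x n y -> rewrites F x m y.
Proof. by move=> le e r; have [b h] := e r; exists b; apply: ex_mono h. Qed.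

Lemma rewrites_seq F G x n y m z :
  rewrites F x n y -> rewrites G y m z -> rewrites (seqf F G) x (n + m).+1 z.
Proof.
by move=> e e' r; have [b h] := e r; have [b' h'] := e' r; exists b'; apply: ex_seq h h'.
Qed.

Lemma rewrites_frame F x n y r : rewrites F x n y -> rewrites F (x ++ r) n (y ++ r).
Proof. by move=> e s; have [b h] := e (r ++ s); exists b; rewrite -!catA. Qed.

Lemma rewrites_push x w : rewrites (push 3 x) w 3 (x :: w).
Proof. by move=> r; exists true; exact: ex_push. Qed.

Lemma rewrites_pop x w : rewrites (pop 3 yes) (x :: w) 1 w.
Proof. by move=> r; exists true; eapply ex_conv; first exact: ex_pop. Qed.

Definition drop_tree := take_tree false false.

Lemma rewrites_drop t :
  rewrites drop_tree (tree_word t) (30 * size (tree_word t) + 10) [::].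
Proof. by move=> r; exists false; apply: ex_take_tree. Qed.

Definition dup_tree := seqf (take_tree true true) (seqf (dump 0) (dump 1)).

Lemma catrev_catrev (T : Type) (s r : seq T) : catrev (catrev s [::]) r = s ++ r.
Proof. by rewrite -/(rev s) catrevE revK. Qed.

Lemma rewrites_dup t :
  rewrites dup_tree (tree_word t) (100 * size (tree_word t) + 50)
    (tree_word t ++ tree_word t).
Proof.
move=> r; exists false; eapply ex_conv.
- eapply ex_seq; first exact: ex_take_tree.
  by eapply ex_seq; [exact: ex_dump_fst|exact: ex_dump_snd].
- by rewrite !catrevE !size_cat !size_rev /=; lia.
- by [].
- by rewrite /= !catrev_catrev catA.
Qed.

(** The first tree, held on tape 0, is poured back before the second, which thereby lands on top. *)
Definition swap_trees :=
  seqf (take_tree true false) (seqf (take_tree false true)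
    (seqf (dump 0) (dump 1))).

Lemma rewrites_swap t u :
  rewrites swap_trees (tree_word t ++ tree_word u)
    (100 * size (tree_word t ++ tree_word u) + 80) (tree_word u ++ tree_word t).
Proof.
move=> r; exists false; eapply ex_conv.
- eapply ex_seq; first by rewrite -catA; exact: ex_take_tree.
  eapply ex_seq; first exact: ex_take_tree.
  by eapply ex_seq; [exact: ex_dump_fst|exact: ex_dump_snd].
- by rewrite !catrevE !size_cat !size_rev /=; lia.
- by [].
- by rewrite /= !catrev_catrev catA.
Qed.

(** * Polynomial-time functions on encoded values *)

Lemma leq_expl m n d : m <= n -> m ^ d <= n ^ d.
Proof. by case: d => // d; rewrite leq_exp2r. Qed.

(* The base [n + 2] absorbs constants, so that a bare power suffices. *)
Definition poly_bounded (f : nat -> nat) := exists d, forall n, f n <= n.+2 ^ d.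

Lemma pb_const c : poly_bounded (fun=> c).
Proof.
exists c => n; apply: leq_trans (ltnW (ltn_expl c (ltnSn 1))) _.
exact: leq_expl.
Qed.

Lemma pb_id : poly_bounded id.
Proof. by exists 1 => n; rewrite expn1; lia. Qed.

Lemma pb_mul f g : poly_bounded f -> poly_bounded g ->
  poly_bounded (fun n => f n * g n).
Proof. by case=> d hf [e hg]; exists (d + e) => n; rewrite expnD leq_mul. Qed.

(** One more factor of the base, which is at least 2, absorbs the sum. *)
Lemma pb_add f g : poly_bounded f -> poly_bounded g ->
  poly_bounded (fun n => f n + g n).
Proof.
case=> d hf [e hg]; exists (d + e).+1 => n; rewrite expnS.
apply: (@leq_trans (2 * n.+2 ^ (d + e))); last exact: leq_mul.
rewrite mul2n -addnn; apply: leq_add.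
  by apply: leq_trans (hf n) _; rewrite leq_exp2l // leq_addr.
by apply: leq_trans (hg n) _; rewrite leq_exp2l // leq_addl.
Qed.

Lemma pb_succ f : poly_bounded f -> poly_bounded (fun n => (f n).+1).
Proof.
move=> hf; have [d h] := pb_add hf (pb_const 1).
by exists d => n; rewrite -addn1.
Qed.

Lemma pb_exp f d : poly_bounded f -> poly_bounded (fun n => f n ^ d).
Proof.
by case=> e h; exists (e * d) => n; rewrite expnM leq_expl.
Qed.

Ltac pb := lazymatch goal with
  | |- poly_bounded (fun _ => ?c) => exact: (pb_const c)
  | |- poly_bounded id => exact: pb_id
  | |- poly_bounded (fun n => n) => exact: pb_id
  | |- poly_bounded (fun n => S (@?f n)) => apply: (@pb_succ f); pb
  | |- poly_bounded (fun n => addn (@?f n) (@?g n)) => apply: (@pb_add f g); pb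
  | |- poly_bounded (fun n => muln (@?f n) (@?g n)) => apply: (@pb_mul f g); pb
  | |- poly_bounded (fun n => expn (@?f n) ?d) => apply: (@pb_exp f d); pb
  end.

Lemma leq_pow2 m n d : m <= n -> m.+2 ^ d <= n.+2 ^ d.
Proof. by move=> h; apply: leq_expl. Qed.

(** * Trees of the basic types *)

Class Enc (T : Type) := enc : T -> tree.
#[export] Instance Enc_unit : Enc unit := fun=> Leaf.
#[export] Instance Enc_bool : Enc bool := fun b => if b then Node Leaf Leaf else Leaf.
(** This is also the tree of the list of [n] units, so that operations on lists serve for
    naturals. *)
#[export] Instance Enc_nat : Enc nat := fun n => iter n (Node Leaf) Leaf.
#[export] Instance Enc_prod A B (eA : Enc A) (eB : Enc B) : Enc (A * B) :=
  fun p => Node (enc p.1) (enc p.2).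
#[export] Instance Enc_option A (eA : Enc A) : Enc (option A) :=
  fun o => if o is Some a then Node Leaf (enc a) else Leaf.
#[export] Instance Enc_seq A (eA : Enc A) : Enc (seq A) :=
  foldr (fun a t => Node (enc a) t) Leaf.

Definition ew {A} {eA : Enc A} (a : A) : word := tree_word (enc a).
Definition sz {A} {eA : Enc A} (a : A) := size (ew a).

Lemma ew_pair A B (eA : Enc A) (eB : Enc B) (a : A) (b : B) :
  ew (a, b) = true :: ew a ++ ew b.
Proof. by []. Qed.

Lemma ew_cons A (eA : Enc A) (a : A) s : ew (a :: s) = true :: ew a ++ ew s.
Proof. by []. Qed.

Lemma sz_pair A B (eA : Enc A) (eB : Enc B) (a : A) (b : B) :
  sz (a, b) = (sz a + sz b).+1.
Proof. by rewrite /sz ew_pair /= size_cat. Qed.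

Lemma sz_cons A (eA : Enc A) (a : A) s : sz (a :: s) = (sz a + sz s).+1.
Proof. by rewrite /sz ew_cons /= size_cat. Qed.

Lemma sz_cat A (eA : Enc A) (s t : seq A) : (sz (s ++ t)).+1 = sz s + sz t.
Proof. by elim: s => [|a s IH]; rewrite ?add1n //= !sz_cons -addnS IH; lia. Qed.

Lemma sz_gt0 A (eA : Enc A) (a : A) : 0 < sz a.
Proof. by rewrite /sz /ew; case: (enc a). Qed.

(** The size bound on the value belongs to the notion because, in a composition, the second running
    time is a function of the size of the intermediate value. *)
Definition polytime {X Y} {eX : Enc X} {eY : Enc Y} (f : X -> Y) := exists F d, forall x,
  rewrites F (ew x) ((sz x).+2 ^ d) (ew (f x)) /\ sz (f x) <= (sz x).+2 ^ d.

Lemma polytime_intro X Y (eX : Enc X) (eY : Enc Y) (f : X -> Y) F T S :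
  poly_bounded T -> poly_bounded S ->
  (forall x, rewrites F (ew x) (T (sz x)) (ew (f x))) ->
  (forall x, sz (f x) <= S (sz x)) -> polytime f.
Proof.
move=> pT pS hT hS; have [d h] := pb_add pT pS; exists F, d => x; split.
  apply: rewrites_mono (hT x); exact: leq_trans (leq_addr _ _) (h _).
exact: leq_trans (hS x) (leq_trans (leq_addl _ _) (h _)).
Qed.

Lemma polytime_ext X Y (eX : Enc X) (eY : Enc Y) (f g : X -> Y) :
  f =1 g -> polytime f -> polytime g.
Proof. by move=> e [F [d h]]; exists F, d => x; rewrite -e. Qed.

(** Recoding between types whose trees coincide leaves the stack as it is; a mere [peek] does it. *)
Lemma polytime_cast X Y (eX : Enc X) (eY : Enc Y) (f : X -> Y) :
  (forall x, enc (f x) = enc x) -> polytime f.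
Proof.
move=> e; apply: (@polytime_intro _ _ _ _ f (peek 3 yes) (fun=> 1) id); [by pb|by pb| |].
  by move=> x r; exists true; rewrite /ew e; apply: ex_peek.
by move=> x; rewrite /sz /ew e.
Qed.

Lemma polytime_id X (eX : Enc X) : polytime (fun x : X => x).
Proof. exact: polytime_cast. Qed.

Lemma polytime_comp X Y Z (eX : Enc X) (eY : Enc Y) (eZ : Enc Z) (f : X -> Y) (g : Y -> Z) :
  polytime f -> polytime g -> polytime (fun x => g (f x)).
Proof.
case=> F [d hF] [G [e hG]].
apply: (@polytime_intro _ _ _ _ _ (seqf F G)
  (fun n => (n.+2 ^ d + (n.+2 ^ d).+2 ^ e).+1) (fun n => (n.+2 ^ d).+2 ^ e)).
- by pb.
- by pb.
- move=> x; have [h1 h2] := hF x; have [h3 h4] := hG (f x).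
  apply: rewrites_mono (rewrites_seq h1 h3); rewrite ltnS leq_add2l.
  exact: leq_pow2.
- move=> x; have [h1 h2] := hF x; have [h3 h4] := hG (f x).
  by apply: leq_trans h4 _; apply: leq_pow2.
Qed.

Lemma polytime_const X Y (eX : Enc X) (eY : Enc Y) (y : Y) : polytime (fun _ : X => y).
Proof.
(* The argument is dropped, then the symbols of [w] are pushed from the last to the first, at 3 + 1
   rounds each. *)
pose F w := foldr (fun x F => seqf F (push 3 x)) drop_tree w.
have h (x : X) w : rewrites (F w) (ew x) (30 * sz x + 10 + 4 * size w) w.
  elim: w => [|b w IH] /=; first by rewrite addn0; apply: rewrites_drop.
  by apply: rewrites_mono (rewrites_seq IH (rewrites_push b w)); lia.
apply: (@polytime_intro _ _ _ _ _ (F (ew y)) (fun n => 30 * n + 10 + 4 * size (ew y))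
  (fun=> sz y)); [by pb|by pb| |by []].
by move=> x; apply: h.
Qed.

Lemma polytime_pair X Y Z (eX : Enc X) (eY : Enc Y) (eZ : Enc Z) (f : X -> Y) (g : X -> Z) :
  polytime f -> polytime g -> polytime (fun x => (f x, g x)).
Proof.
case=> F [d hF] [G [e hG]].
(* From the top, the stack holds in turn [x], [x]; then [g x], [x]; then [x], [g x]; then [f x],
   [g x]; and finally the tag of the pair is added. *)
pose H := seqf dup_tree (seqf G (seqf swap_trees (seqf F (push 3 true)))).
apply: (@polytime_intro _ _ _ _ _ H
  (fun n => 1000 + 200 * n + n.+2 ^ d + 101 * n.+2 ^ e)
  (fun n => (n.+2 ^ d + n.+2 ^ e).+1)).
- by pb.
- by pb.
- move=> x; have [h1 h2] := hF x; have [h3 h4] := hG x.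
  have r := rewrites_seq (rewrites_frame _ h1) (rewrites_push true (@ew _ eY (f x) ++ @ew _
    eZ (g x))).
  have {}r := rewrites_seq (rewrites_swap (@enc _ eZ (g x)) (@enc _ eX x)) r.
  have {}r := rewrites_seq (rewrites_frame _ h3) r.
  have := rewrites_seq (rewrites_dup (@enc _ eX x)) r.
  apply: rewrites_mono; rewrite size_cat -/(ew _) -/(ew _) -/(sz _) -/(sz _).
  move: h2 h4; lia.
- move=> x; have [h1 h2] := hF x; have [h3 h4] := hG x.
  by rewrite sz_pair ltnS leq_add.
Qed.

Lemma polytime_fst0 X Y (eX : Enc X) (eY : Enc Y) : polytime (fun p : X * Y => p.1).
Proof.
apply: (@polytime_intro _ _ _ _ _ (seqf (pop 3 yes) (seqf swap_trees drop_tree))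
  (fun n => 200 * n + 200) id); [by pb|by pb| |]; case=> x y.
  have r := rewrites_seq (rewrites_swap (@enc _ eX x) (@enc _ eY y)) (rewrites_frame _
    (rewrites_drop (@enc _ eY y))).
  have := rewrites_seq (rewrites_pop true _) r.
  apply: rewrites_mono; rewrite sz_pair size_cat /= -/(ew _) -/(ew _) -/(sz _) -/(sz _).
  by lia.
by rewrite sz_pair /=; lia.
Qed.

Lemma polytime_snd0 X Y (eX : Enc X) (eY : Enc Y) : polytime (fun p : X * Y => p.2).
Proof.
apply: (@polytime_intro _ _ _ _ _ (seqf (pop 3 yes) drop_tree)
  (fun n => 200 * n + 200) id); [by pb|by pb| |]; case=> x y.
  have := rewrites_seq (rewrites_pop true _) (rewrites_frame (@ew _ eY y) (rewrites_drop
    (@enc _ eX x))).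
  apply: rewrites_mono; rewrite sz_pair /= -/(ew _) -/(sz _).
  by lia.
by rewrite sz_pair /=; lia.
Qed.

(* A nonempty list is encoded as the pair of its head and tail, [true] as
   [(tt, tt)] and [Some a] as [(tt, a)]; [view] exposes that pair. *)
Lemma polytime_case X A B Y Z (eX : Enc X) (eA : Enc A) (eB : Enc B) (eY : Enc Y) (eZ : Enc Z)
    (view : X -> option (A * B)) (f : Y -> Z) (g : (A * B) * Y -> Z) :
  (forall x, enc x = if view x is Some p then enc p else Leaf) -> polytime f -> polytime g ->
  polytime (fun p : X * Y => if view p.1 is Some q then g (q, p.2) else f p.2).
Proof.
move=> hv [F [d hF]] [G [e hG]].
(* Once the tag of the pair is removed, the top symbol tells whether [x] is a leaf. If it is not,
   its word is already that of [q], and restoring the tag yields [(q, y)] without any copying. *)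
pose H := branch (seqf (pop 3 yes) (peek 3 is_true_top)) (seqf (push 3 true) G)
                 (seqf (pop 3 yes) F).
apply: (@polytime_intro _ _ _ _ _ H (fun n => n.+2 ^ d + n.+2 ^ e + 20)
  (fun n => n.+2 ^ d + n.+2 ^ e)); [by pb|by pb| |]; case=> x y /=.
  move=> r; rewrite ew_pair; case: (view x) (hv x) => [[u v]|] hx; rewrite [@ew _ eX x]/ew hx.
    set q := (u, v).
    have [h _] := hG (q, y); have [b h'] := h r; exists b.
    eapply ex_conv.
    - eapply ex_branch; [eapply ex_seq; [exact: ex_pop|exact: ex_peek]|].
      by rewrite /=; eapply ex_seq; [exact: ex_push|exact: h'].
    - have -> : sz (x, y) = sz (q, y) by rewrite (sz_pair _ _ x y) (sz_pair _ _ q y) /sz /ew hx.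
      by lia.
    - by [].
    - by [].
  have [h _] := hF y; have [b h'] := h r; exists b.
  eapply ex_conv.
  - eapply ex_branch; [eapply ex_seq; [exact: ex_pop|exact: ex_peek]|].
      by rewrite /=; eapply ex_seq; [exact: ex_pop|exact: h'].
  - have : (sz y).+2 ^ d <= (sz (x, y)).+2 ^ d.
      by apply: leq_pow2; rewrite sz_pair; lia.
    by lia.
  - by [].
  - by [].
case: (view x) (hv x) => [q|] hx.
  have [_ h] := hG (q, y); apply: leq_trans h _.
  have -> : sz (x, y) = sz (q, y) by rewrite (sz_pair _ _ x y) (sz_pair _ _ q y) /sz /ew hx.
  exact: leq_addl.
have [_ h] := hF y; apply: leq_trans h (leq_trans _ (leq_addr _ _)).
by apply: leq_pow2; rewrite sz_pair; lia.
Qed.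

(** Brings the argument of a fold step, element and accumulator, to the front of the stack, with the
    remaining list below. *)
Lemma polytime_shuffle A B C (eA : Enc A) (eB : Enc B) (eC : Enc C) :
  polytime (fun p : (A * B) * C => ((p.1.1, p.2), p.1.2)).
Proof.
have h1 := polytime_fst0 (Enc_prod eA eB) eC.
apply: polytime_pair; first apply: polytime_pair.
- exact: polytime_comp h1 (polytime_fst0 _ _).
- exact: polytime_snd0.
- exact: polytime_comp h1 (polytime_snd0 _ _).
Qed.

Lemma polytime_foldl_core X A B (eX : Enc X) (eA : Enc A) (eB : Enc B)
    (l : X -> seq A) (i : X -> B) (step : A * B -> B) (S : nat -> nat) :
  polytime (fun x => (l x, i x)) -> polytime step -> poly_bounded S ->
  (forall x s1 s2, l x = s1 ++ s2 ->
     sz (foldl (fun b a => step (a, b)) (i x) s1) <= S (sz x)) ->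
  polytime (fun x => foldl (fun b a => step (a, b)) (i x) (l x)).
Proof.
case=> F0 [d0 hF0] [F1 [d1 hF1]] pS hS.
have [F2 [d2 hF2]] := polytime_shuffle eA (Enc_seq eA) eB.
(* The stack holds the pair of the remaining list and the accumulator. If the list is a leaf, it is
   popped and the accumulator remains. Otherwise the tag is restored and the triple shuffled;
   popping the outer tag then lets [F1] act on [(a, b)] alone, with the list as frame. *)
pose G := branch (seqf (pop 3 yes) (peek 3 is_true_top))
  (seqf (push 3 true) (seqf F2 (seqf (pop 3 yes) (seqf F1
     (seqf swap_trees (push 3 true))))))
  (pop 3 no).
(* Cost of one round when the current pair of list and accumulator, as well as the next accumulator,
   have size at most [M]. *)
pose T M := M.+2 ^ d2 + M.+2 ^ d1 + 200 * M + 100.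
have step_ok M a s b r : sz (a :: s, b) <= M -> sz (step (a, b)) <= M ->
    ex G [:: [::]; [::]; [::]; ew (a :: s, b) ++ r] (T M) true
         [:: [::]; [::]; [::]; ew (s, step (a, b)) ++ r].
  move=> le1 le2.
  have [/(_ r)[b2 h2] _] := hF2 ((a, s), b).
  have [/(_ (ew s ++ r))[b1 h1] _] := hF1 (a, b).
  have [b3 h3] := rewrites_swap (enc (step (a, b))) (enc s) r.
  rewrite -catA in h3.
  have hpop : ex (pop 3 yes) [:: [::]; [::]; [::]; ew ((a, b), s) ++ r] 1 true
      [:: [::]; [::]; [::]; ew (a, b) ++ (ew s ++ r)].
    by eapply ex_conv; [exact: ex_pop|..] => //=; rewrite catA.
  eapply ex_conv.
  - eapply ex_branch; [eapply ex_seq; [exact: ex_pop|exact: ex_peek]|].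
    rewrite /=; eapply ex_seq; [exact: ex_push|].
    eapply ex_seq; [exact: h2|].
    eapply ex_seq; [exact: hpop|].
    eapply ex_seq; [exact: h1|].
    eapply ex_seq; [exact: h3|exact: ex_push].
  - rewrite /T size_cat -/(ew _) -/(ew _) -/(sz _) -/(sz _).
    have : (sz ((a, s), b)).+2 ^ d2 <= M.+2 ^ d2 by apply: leq_pow2.
    have : (sz (a, b)).+2 ^ d1 <= M.+2 ^ d1.
      by apply: leq_pow2; move: le1; rewrite !sz_pair sz_cons; lia.
    by move: le1; rewrite !sz_pair sz_cons; lia.
  - by [].
  - by [].
have loop_ok M s b r :
    (forall s1 s2, s = s1 ++ s2 ->
       (sz s + sz (foldl (fun b a => step (a, b)) b s1)).+1 <= M) ->
    ex (loop G) [:: [::]; [::]; [::]; ew (s, b) ++ r] (size s * (T M).+1 + 50) false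
         [:: [::]; [::]; [::]; ew (foldl (fun b a => step (a, b)) b s) ++ r].
  elim: s b => [|a s IHs] b hM.
    eapply ex_conv.
    - apply: ex_loop_exit; eapply ex_branch.
        by eapply ex_seq; [exact: ex_pop|exact: ex_peek].
      by rewrite /=; exact: ex_pop.
    - by lia.
    - by [].
    - by [].
  have := hM [::] (a :: s) erefl; rewrite -sz_pair => hM0.
  have := hM [:: a] s erefl => /= hM1.
  have {}IHs := IHs (step (a, b)).
  eapply ex_conv.
  - eapply ex_loop_next; last apply: IHs.
      by apply: step_ok; [exact: hM0|lia].
    move=> s1 s2 e; have := hM (a :: s1) s2; rewrite e => /(_ erefl) /=.
    by rewrite !sz_cons; lia.
  - by rewrite /=; lia.
  - by [].
  - by [].
(* [F0] outputs the list along with the initial accumulator, so [n.+2 ^ d0] bounds the list, while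
   [S] bounds the accumulators. *)
pose Q n := (n.+2 ^ d0 + S n).+1.
apply: (@polytime_intro _ _ _ _ _ (seqf F0 (loop G))
   (fun n => (n.+2 ^ d0 + (n.+2 ^ d0 * (T (Q n)).+1 + 50)).+1) S).
- have [e hS'] := pS.
  have pQ : poly_bounded Q by apply: pb_succ; apply: pb_add => //; pb.
  have pT : poly_bounded (fun n => T (Q n)).
    rewrite /T; apply: pb_add; last by pb.
    apply: pb_add; last by apply: pb_mul => //; pb.
    by apply: pb_add; apply: pb_exp; apply: pb_succ; apply: pb_succ.
  apply: pb_succ; apply: pb_add; first by pb.
  apply: pb_add; last by pb.
  by apply: pb_mul; [by pb|apply: pb_succ].
- exact: pS.
- move=> x r; have [h h'] := hF0 x; have [b hb] := h r; exists false.
  apply: (ex_mono _ (ex_seq hb (loop_ok (Q (sz x)) _ _ _ _))).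
    rewrite ltnS leq_add2l leq_add2r leq_mul2r /=.
    apply: leq_trans h'; rewrite sz_pair.
    have : size (l x) <= sz (l x) by elim: (l x) => // a s IH; rewrite sz_cons /=; lia.
    by lia.
  move=> s1 s2 e; rewrite /Q ltnS leq_add //; last exact: hS e.
  by apply: leq_trans h'; rewrite sz_pair; lia.
- move=> x; have := hS x (l x) [::]; rewrite cats0; exact.
Qed.

Section Closure.
Context {X : Type} {eX : Enc X}.

Lemma polytime_fst A B (eA : Enc A) (eB : Enc B) (f : X -> A * B) :
  polytime f -> polytime (fun x => (f x).1).
Proof. by move=> h; apply: polytime_comp h (polytime_fst0 _ _). Qed.

Lemma polytime_snd A B (eA : Enc A) (eB : Enc B) (f : X -> A * B) :
  polytime f -> polytime (fun x => (f x).2).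
Proof. by move=> h; apply: polytime_comp h (polytime_snd0 _ _). Qed.

Lemma polytime_app2 A B C (eA : Enc A) (eB : Enc B) (eC : Enc C) (op : A -> B -> C)
    (f : X -> A) (g : X -> B) :
  polytime (fun p => op p.1 p.2) -> polytime f -> polytime g -> polytime (fun x =>
    op (f x) (g x)).
Proof. by move=> h hf hg; have := polytime_comp (polytime_pair hf hg) h. Qed.

Lemma polytime_recode A B (eA : Enc A) (eB : Enc B) (c : A -> B) (f : X -> A) :
  (forall a, enc (c a) = enc a) -> polytime f -> polytime (fun x => c (f x)).
Proof. by move=> e h; apply: polytime_comp h (polytime_cast _). Qed.

Lemma polytime_cons A (eA : Enc A) (f : X -> A) (g : X -> seq A) :
  polytime f -> polytime g -> polytime (fun x => f x :: g x).
Proof.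
move=> hf hg.
by have := @polytime_recode (A * seq A) (seq A) _ _ (fun p =>
  p.1 :: p.2) _ _ (polytime_pair hf hg); apply.
Qed.

Lemma polytime_Some A (eA : Enc A) (f : X -> A) : polytime f -> polytime (fun x => Some (f x)).
Proof.
move=> hf.
by have := @polytime_recode (unit * A) (option A) _ _ (fun p => Some p.2) _ _
  (polytime_pair (polytime_const _ _ tt) hf); apply.
Qed.

Lemma polytime_succ (f : X -> nat) : polytime f -> polytime (fun x => (f x).+1).
Proof.
move=> hf.
by have := @polytime_recode (unit * nat) nat _ _ (fun p => p.2.+1) _ _
  (polytime_pair (polytime_const _ _ tt) hf); apply.
Qed.

Lemma polytime_if A (eA : Enc A) (b : X -> bool) (f g : X -> A) :
  polytime b -> polytime f -> polytime g -> polytime (fun x => if b x then f x else g x).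
Proof.
move=> hb hf hg.
have h := @polytime_case bool unit unit X A Enc_bool Enc_unit Enc_unit eX eA
  (fun b => if b then Some (tt, tt) else None) g (fun p => f p.2) _ hg
  (polytime_comp (polytime_snd0 _ _) hf).
have {}h := polytime_comp (polytime_pair hb (polytime_id eX)) (h _).
by apply: polytime_ext (h _) => [x|[]] //=; case: (b x).
Qed.

Lemma polytime_match_seq A B (eA : Enc A) (eB : Enc B) (s : X -> seq A)
    (f : X -> B) (g : X -> A -> seq A -> B) :
  polytime s -> polytime f -> polytime (fun p => g p.1.1 p.1.2 p.2) ->
  polytime (fun x => if s x is a :: s' then g x a s' else f x).
Proof.
move=> hs hf hg.
have hg' : polytime (fun p : (A * seq A) * X => g p.2 p.1.1 p.1.2).
  have h1 := polytime_fst0 (Enc_prod eA (Enc_seq eA)) eX.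
  apply: (polytime_comp (f := fun p : (A * seq A) * X => ((p.2, p.1.1), p.1.2)) _ hg).
  apply: polytime_pair; first apply: polytime_pair.
  - exact: polytime_snd0.
  - exact: polytime_comp h1 (polytime_fst0 _ _).
  - exact: polytime_comp h1 (polytime_snd0 _ _).
have h := @polytime_case (seq A) A (seq A) X B (Enc_seq eA) eA (Enc_seq eA) eX eB
  (fun s => if s is a :: s' then Some (a, s') else None) f _ _ hf hg'.
have {}h := polytime_comp (polytime_pair hs (polytime_id eX)) (h _).
by apply: polytime_ext (h _) => [x|[]] //=; case: (s x).
Qed.

Lemma polytime_match_option A B (eA : Enc A) (eB : Enc B) (o : X -> option A)
    (f : X -> B) (g : X -> A -> B) :
  polytime o -> polytime f -> polytime (fun p => g p.1 p.2) ->
  polytime (fun x => if o x is Some a then g x a else f x).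
Proof.
move=> ho hf hg.
have hg' : polytime (fun p : (unit * A) * X => g p.2 p.1.2).
  have h1 := polytime_fst0 (Enc_prod Enc_unit eA) eX.
  apply: (polytime_comp (f := fun p : (unit * A) * X => (p.2, p.1.2)) _ hg).
  by apply: polytime_pair; [exact: polytime_snd0|exact: polytime_comp h1 (polytime_snd0 _ _)].
have h := @polytime_case (option A) unit A X B (Enc_option eA) Enc_unit eA eX eB
  (omap (fun a => (tt, a))) f _ _ hf hg'.
have {}h := polytime_comp (polytime_pair ho (polytime_id eX)) (h _).
by apply: polytime_ext (h _) => [x|[]] //=; case: (o x).
Qed.

Lemma polytime_foldl A B (eA : Enc A) (eB : Enc B) (l : X -> seq A) (i : X -> B)
    (g : X -> B -> A -> B) (S : nat -> nat) :
  polytime l -> polytime i -> polytime (fun p => g p.1.1 p.1.2 p.2) -> poly_bounded S ->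
  (forall x s1 s2, l x = s1 ++ s2 -> sz (foldl (g x) (i x) s1) <= S (sz x)) ->
  polytime (fun x => foldl (g x) (i x) (l x)).
Proof.
move=> hl hi hg pS hS.
(* The core rule has a step without parameter, so the accumulator carries [x] along and drops it at
   the end. *)
pose step (p : A * (B * X)) := (g p.2.2 p.2.1 p.1, p.2.2).
have foldE x s b : foldl (fun b a => step (a, b)) (b, x) s = (foldl (g x) b s, x).
  by elim: s b => //= a s IH b; rewrite IH.
have hstep : polytime step.
  have h1 := polytime_fst0 eA (Enc_prod eB eX).
  have h2 := polytime_snd0 eA (Enc_prod eB eX).
  have h21 := polytime_comp h2 (polytime_fst0 _ _).
  have h22 := polytime_comp h2 (polytime_snd0 _ _).
  apply: polytime_pair (h22).
  exact: (polytime_comp (polytime_pair (polytime_pair h22 h21) h1) hg).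
have h := @polytime_foldl_core X A (B * X) eX eA (Enc_prod eB eX) l (fun x => (i x, x)) step
  (fun n => (S n + n).+1) (polytime_pair hl (polytime_pair hi (polytime_id _))) hstep.
have {}h := polytime_comp (h _ _) (polytime_fst0 _ _).
apply: polytime_ext (h _ _) => [x||x s1 s2 e]; first by rewrite foldE.
  by apply: pb_succ; apply: pb_add => //; pb.
by rewrite foldE sz_pair ltnS leq_add2r; apply: hS e.
Qed.

End Closure.

Lemma polytime_sz X Y (eX : Enc X) (eY : Enc Y) (f : X -> Y) : polytime f ->
  exists d, forall x, sz (f x) <= (sz x).+2 ^ d.
Proof. by case=> F [d h]; exists d => x; have [] := h x. Qed.

Lemma size_sz A (eA : Enc A) (s : seq A) : size s <= sz s.
Proof. by elim: s => //= a s IH; rewrite sz_cons; lia. Qed.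

Lemma sz_succ n : sz n.+1 = (sz n).+2. Proof. by []. Qed.

Lemma sz_nat n : sz n = n.*2.+1.
Proof. by elim: n => // n IH; rewrite sz_succ IH. Qed.

Lemma sz_bool (b : bool) : sz b <= 3. Proof. by case: b. Qed.

Lemma sz_Some A (eA : Enc A) (a : A) : sz (Some a) = (sz a).+2.
Proof. by []. Qed.

Lemma sz_word (w : seq bool) : sz w <= 4 * size w + 1.
Proof. by elim: w => // b w IH; rewrite sz_cons /=; have := sz_bool b; lia. Qed.

Lemma size_word_sz (w : seq bool) : size w <= sz w.
Proof. exact: size_sz. Qed.

(** Extension point of [pt], redefined each time further operations have been shown
    polynomial-time. *)
Ltac pt_op := fail.

Ltac pt := cbv beta zeta; lazymatch goal with
  | |- polytime (@fst _ _) => exact: polytime_fst0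
  | |- polytime (@snd _ _) => exact: polytime_snd0
  | |- polytime (fun x => x) => exact: polytime_id
  | |- polytime (fun _ => ?c) => exact: polytime_const
  | |- polytime (fun x => pair (@?f x) (@?g x)) =>
    refine (@polytime_pair _ _ _ _ _ _ f g _ _); pt
  | |- polytime (fun x => fst (@?f x)) => refine (@polytime_fst _ _ _ _ _ _ f _); pt
  | |- polytime (fun x => snd (@?f x)) => refine (@polytime_snd _ _ _ _ _ _ f _); pt
  | |- polytime (fun x => cons (@?f x) (@?g x)) => refine (@polytime_cons _ _ _ _ f g _ _); pt
  | |- polytime (fun x => Some (@?f x)) => refine (@polytime_Some _ _ _ _ f _); pt
  | |- polytime (fun x => S (@?f x)) => refine (@polytime_succ _ _ f _); pt
  | |- _ => first [assumption | pt_op; pt | apply: polytime_if; pt | idtac]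
  end.

(** An increment independent of the accumulator rules out repeated doubling: the growth is linear in
    the length of the list. *)
Lemma foldl_grow A B (eA : Enc A) (eB : Enc B) (g : B -> A -> B) K N b (s : seq A) :
  (forall b a, sz a <= N -> sz (g b a) <= sz b + K) -> sz s <= N ->
  sz (foldl g b s) <= sz b + size s * K.
Proof.
move=> h; elim: s b => [|a s IH] b /=; first by lia.
rewrite sz_cons => le; apply: leq_trans (IH _ _) _; first by lia.
by have := h b a; rewrite mulSn; lia.
Qed.

Lemma polytime_foldl_grow X A B (eX : Enc X) (eA : Enc A) (eB : Enc B) (l : X -> seq A)
    (i : X -> B) (g : X -> B -> A -> B) (K : nat -> nat) :
  polytime l -> polytime i -> polytime (fun p => g p.1.1 p.1.2 p.2) -> poly_bounded K ->
  (forall x b a, sz a <= sz (l x) -> sz (g x b a) <= sz b + K (sz x)) ->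
  polytime (fun x => foldl (g x) (i x) (l x)).
Proof.
move=> hl hi hg pK hK.
have [d1 h1] := polytime_sz hl; have [d2 h2] := polytime_sz hi.
apply: (polytime_foldl (S := fun n => n.+2 ^ d2 + n.+2 ^ d1 * K n)) => //.
  apply: pb_add; first by pb.
  by apply: pb_mul => //; pb.
move=> x s1 s2 e.
have le1 : sz s1 <= sz (l x) by rewrite e; have := sz_cat eA s1 s2; have :=
  sz_gt0 (Enc_seq eA) s2; lia.
apply: leq_trans (foldl_grow (K := K (sz x)) (i x) _ le1) _; first exact: hK.
apply: leq_add; first exact: h2.
rewrite leq_mul2r; apply/orP; right.
by apply: leq_trans (h1 x); apply: leq_trans (size_sz _ _) le1.
Qed.

Lemma polytime_iter X B (eX : Enc X) (eB : Enc B) (n : X -> nat) (i : X -> B)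
    (g : X -> B -> B) (S : nat -> nat) :
  polytime n -> polytime i -> polytime (fun p => g p.1 p.2) -> poly_bounded S ->
  (forall x k, k <= n x -> sz (iter k (g x) (i x)) <= S (sz x)) ->
  polytime (fun x => iter (n x) (g x) (i x)).
Proof.
move=> hn hi hg pS hS.
have iterE x (s : seq unit) : foldl (fun b _ => g x b) (i x) s = iter (size s) (g x) (i x).
  by elim: s (i x) => //= a s IH b; rewrite IH -iterSr.
have h1 := polytime_fst0 (Enc_prod eX eB) Enc_unit.
(* Iteration becomes a fold over a list of units, which has the same tree as the number of
   rounds. *)
have hn' : polytime (fun x => nseq (n x) tt).
  by apply: (polytime_recode (c := fun k => nseq k tt)) hn; elim=> // k; rewrite /enc /= => ->.
have := @polytime_foldl X eX unit B _ eB _ i (fun x b _ =>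
  g x b) S hn' hi (polytime_comp h1 hg) pS.
move=> h; apply: polytime_ext (h _) => [x|x s1 s2 e]; first by rewrite iterE size_nseq.
rewrite iterE; apply: hS.
by have := congr1 size e; rewrite size_nseq size_cat; lia.
Qed.

Lemma polytime_iter_grow X B (eX : Enc X) (eB : Enc B) (n : X -> nat) (i : X -> B)
    (g : X -> B -> B) (K : nat -> nat) :
  polytime n -> polytime i -> polytime (fun p => g p.1 p.2) -> poly_bounded K ->
  (forall x b, sz (g x b) <= sz b + K (sz x)) ->
  polytime (fun x => iter (n x) (g x) (i x)).
Proof.
move=> hn hi hg pK hK.
have [d1 h1] := polytime_sz hn; have [d2 h2] := polytime_sz hi.
apply: (polytime_iter (S := fun n => n.+2 ^ d2 + n.+2 ^ d1 * K n)) => //.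
  apply: pb_add; first by pb.
  by apply: pb_mul => //; pb.
move=> x k le.
have h4 : sz (iter k (g x) (i x)) <= sz (i x) + k * K (sz x).
  elim: k {le} => [|k IH] /=; first by lia.
  by have := hK x (iter k (g x) (i x)); rewrite mulSn; lia.
have h3 : k <= (sz x).+2 ^ d1 by have := h1 x; rewrite sz_nat; lia.
by apply: leq_trans h4 (leq_add (h2 x) _); apply: leq_mul.
Qed.

(** * Booleans, naturals and lists *)

Section Ops.
Context {X : Type} {eX : Enc X}.

Lemma polytime_negb (f : X -> bool) : polytime f -> polytime (fun x => ~~ f x).
Proof. by move=> hf; rewrite /negb; pt. Qed.

Lemma polytime_andb (f g : X -> bool) : polytime f -> polytime g -> polytime (fun x =>
  f x && g x).
Proof. by move=> hf hg; rewrite /andb; pt. Qed.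

Lemma polytime_orb (f g : X -> bool) : polytime f -> polytime g -> polytime (fun x =>
  f x || g x).
Proof. by move=> hf hg; rewrite /orb; pt. Qed.

Lemma polytime_addb (f g : X -> bool) : polytime f -> polytime g -> polytime (fun x =>
  f x (+) g x).
Proof.
move=> hf hg; apply: (polytime_ext (f := fun x => if f x then ~~ g x else g x)).
  by move=> x; case: (f x).
by apply: polytime_if => //; apply: polytime_negb.
Qed.

Lemma polytime_behead A (eA : Enc A) (f : X -> seq A) : polytime f -> polytime (fun x =>
  behead (f x)).
Proof.
move=> hf; have h : polytime (fun p : X * A * seq A => p.2) by pt.
have := polytime_match_seq (f := fun=> [::]) (g := fun _ _ s => s) hf (polytime_const _ _ _) h.
by apply: polytime_ext => x; case: (f x).
Qed.

Lemma polytime_head A (eA : Enc A) a (f : X -> seq A) : polytime f -> polytime (fun x =>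
  head a (f x)).
Proof.
move=> hf; have h : polytime (fun p : X * A * seq A => p.1.2) by pt.
have := polytime_match_seq (f := fun=> a) (g := fun _ a _ => a) hf (polytime_const _ _ _) h.
by apply: polytime_ext => x; case: (f x).
Qed.

Lemma polytime_nilp A (eA : Enc A) (f : X -> seq A) : polytime f -> polytime (fun x =>
  nilp (f x)).
Proof.
move=> hf; have h : polytime (fun p : X * A * seq A => false) by pt.
have := polytime_match_seq (f := fun=> true) (g := fun _ _ _ =>
  false) hf (polytime_const _ _ _) h.
by apply: polytime_ext => x; case: (f x).
Qed.

Lemma enc_nseq n : enc (nseq n tt) = enc n.
Proof. by elim: n => // n; rewrite /enc /= => ->. Qed.

(** The predecessor is [behead], seen through the identification of naturals with lists of units. *)
Lemma polytime_pred (f : X -> nat) : polytime f -> polytime (fun x => (f x).-1).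
Proof.
move=> hf.
apply: (polytime_ext (f := fun x => size (behead (nseq (f x) tt)))).
  by move=> x; rewrite size_behead size_nseq.
apply: (polytime_recode (c := @size unit)); last first.
  by apply: polytime_behead; apply: polytime_recode hf; apply: enc_nseq.
by elim=> // [[]] s; rewrite /enc /= => ->.
Qed.

Lemma polytime_eq0 (f : X -> nat) : polytime f -> polytime (fun x => f x == 0).
Proof.
move=> hf.
have /polytime_nilp : polytime (fun x => nseq (f x) tt) by apply: polytime_recode hf;
  apply: enc_nseq.
by apply: polytime_ext => x; case: (f x).
Qed.

End Ops.

Ltac pt_op ::= lazymatch goal with
  | |- polytime (fun x => negb (@?f x)) => apply: (polytime_negb (f := f))
  | |- polytime (fun x => andb (@?f x) (@?g x)) => apply: (polytime_andb (f := f) (g := g))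
  | |- polytime (fun x => orb (@?f x) (@?g x)) => apply: (polytime_orb (f := f) (g := g))
  | |- polytime (fun x => addb (@?f x) (@?g x)) => apply: (polytime_addb (f := f) (g := g))
  | |- polytime (fun x => behead (@?f x)) => apply: (polytime_behead (f := f))
  | |- polytime (fun x => head ?a (@?f x)) => apply: (polytime_head a (f := f))
  | |- polytime (fun x => nilp (@?f x)) => apply: (polytime_nilp (f := f))
  | |- polytime (fun x => predn (@?f x)) => apply: (polytime_pred (f := f))
  | |- polytime (fun x => eq_op (@?f x) 0) => apply: (polytime_eq0 (f := f))
  end.

Section Ops2.
Context {X : Type} {eX : Enc X}.

Lemma polytime_subn (f g : X -> nat) : polytime f -> polytime g -> polytime (fun x =>
  f x - g x).
Proof.
move=> hf hg; apply: (polytime_ext (f := fun x => iter (g x) predn (f x))).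
  by move=> x; elim: (g x) => [|n /= ->]; rewrite ?subn0 ?subnS.
apply: (polytime_iter_grow (g := fun _ => predn) (K := fun=> 0)) => //.
- by pt.
- exact: pb_const.
- by move=> _ n; rewrite !sz_nat; lia.
Qed.

Lemma polytime_eqn (f g : X -> nat) : polytime f -> polytime g -> polytime (fun x =>
  f x == g x).
Proof.
move=> hf hg; apply: (polytime_ext (f := fun x => (f x - g x == 0) && (g x - f x == 0))).
  by move=> x; rewrite !subn_eq0 eqn_leq.
by pt; apply: polytime_subn.
Qed.

Lemma polytime_size A (eA : Enc A) (f : X -> seq A) : polytime f -> polytime (fun x =>
  size (f x)).
Proof.
move=> hf; apply: (polytime_ext (f := fun x => foldl (fun n _ => n.+1) 0 (f x))).
  have h (s : seq A) n : foldl (fun n _ => n.+1) n s = size s + n.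
    by elim: s n => //= a s IH n; rewrite IH addnS.
  by move=> x; rewrite h addn0.
apply: (polytime_foldl_grow (g := fun _ n _ => n.+1) (K := fun=> 2)) => //; last 2 first.
- exact: pb_const.
- by move=> x b a _; rewrite !sz_nat; lia.
- by pt.
- by pt.
Qed.

Lemma sz_catrev A (eA : Enc A) (s t : seq A) : (sz (catrev s t)).+1 = sz s + sz t.
Proof. by elim: s t => [|a s IH] t /=; rewrite ?add1n // IH !sz_cons; lia. Qed.

Lemma catrev_foldl A (s t : seq A) : catrev s t = foldl (fun u a => a :: u) t s.
Proof. by elim: s t => //= a s IH t. Qed.

Lemma polytime_catrev A (eA : Enc A) (f g : X -> seq A) : polytime f -> polytime g ->
  polytime (fun x => catrev (f x) (g x)).
Proof.
move=> hf hg; apply: (polytime_ext (f := fun x => foldl (fun u a => a :: u) (g x) (f x))).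
  by move=> x; rewrite catrev_foldl.
have [d h] := polytime_sz hf.
apply: (polytime_foldl_grow (g := fun _ u a => a :: u) (K := fun n => (n.+2 ^ d).+1)) => //.
- by pt.
- by pb.
- by move=> x b a; rewrite sz_cons; have := h x; lia.
Qed.

Lemma polytime_rev A (eA : Enc A) (f : X -> seq A) : polytime f -> polytime (fun x =>
  rev (f x)).
Proof. by move=> hf; apply: polytime_catrev => //; pt. Qed.

Lemma polytime_cat A (eA : Enc A) (f g : X -> seq A) : polytime f -> polytime g ->
  polytime (fun x => f x ++ g x).
Proof.
move=> hf hg; apply: (polytime_ext (f := fun x => catrev (rev (f x)) (g x))).
  by move=> x; rewrite catrevE revK.
by apply: polytime_catrev => //; apply: polytime_rev.
Qed.

End Ops2.

Section Ops3.
Context {X : Type} {eX : Enc X}.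

Lemma polytime_map A B (eA : Enc A) (eB : Enc B) (g : X -> A -> B) (l : X -> seq A) :
  polytime (fun p => g p.1 p.2) -> polytime l -> polytime (fun x => [seq g x a | a <- l x]).
Proof.
move=> hg hl; apply: (polytime_ext (f := fun x => rev (foldl (fun u a =>
  g x a :: u) [::] (l x)))).
  have h x (s : seq A) u :
      foldl (fun u a => g x a :: u) u s = catrev [seq g x a | a <- s] u.
    by elim: s u => //= a s IH u; rewrite IH.
  by move=> x; rewrite h -/(rev _) revK.
apply: polytime_rev; have [d1 h1] := polytime_sz hl; have [d2 h2] := polytime_sz hg.
apply: (polytime_foldl_grow (g := fun x u a => g x a :: u)
         (K := fun n => ((n + n.+2 ^ d1).+1.+2 ^ d2).+1)) => //.
- by pt.
- by apply: (polytime_cons (f := fun p : X * seq B * A => g p.1.1 p.2)); last pt;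
    have h : polytime (fun p : X * seq B * A => (p.1.1, p.2)) by [pt|];
      exact: polytime_comp h hg.
- by pb.
- move=> x b a le; rewrite sz_cons addnC -addnS leq_add2l ltnS.
  apply: leq_trans (h2 (x, a)) _; apply: leq_pow2.
  by rewrite sz_pair; have := h1 x; lia.
Qed.

Lemma polytime_flatten A (eA : Enc A) (l : X -> seq (seq A)) :
  polytime l -> polytime (fun x => flatten (l x)).
Proof.
move=> hl; apply: (polytime_ext (f := fun x => rev (foldl (fun u s => catrev s u) [::] (l x)))).
  have h (s : seq (seq A)) u :
      foldl (fun u s => catrev s u) u s = catrev (flatten s) u.
    by elim: s u => //= a s IH u; rewrite IH !catrevE rev_cat catA.
  by move=> x; rewrite h -/(rev _) revK.
apply: polytime_rev; have [d1 h1] := polytime_sz hl.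
apply: (polytime_foldl_grow (g := fun x u s => catrev s u) (K := fun n => n.+2 ^ d1)) => //.
- by pt.
- by apply: polytime_catrev; pt.
- by pb.
- by move=> x b a; have := sz_catrev eA a b; have := h1 x; lia.
Qed.

Lemma polytime_filter A (eA : Enc A) (g : X -> A -> bool) (l : X -> seq A) :
  polytime (fun p => g p.1 p.2) -> polytime l -> polytime (fun x => [seq a <- l x | g x a]).
Proof.
move=> hg hl.
apply: (polytime_ext (f := fun x => flatten [seq if g x a then [:: a] else [::] | a <- l x])).
  by move=> x; elim: (l x) => //= a s ->; case: (g x a).
by apply: polytime_flatten; apply: (polytime_map (g := fun x a =>
  if g x a then [:: a] else [::])); pt.
Qed.

Lemma polytime_all A (eA : Enc A) (g : X -> A -> bool) (l : X -> seq A) :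
  polytime (fun p => g p.1 p.2) -> polytime l -> polytime (fun x => all (g x) (l x)).
Proof.
move=> hg hl; apply: (polytime_ext (f := fun x => nilp [seq a <- l x | ~~ g x a])).
  by move=> x; elim: (l x) => //= a s <-; case: (g x a).
by apply: polytime_nilp; apply: (polytime_filter (g := fun x a => ~~ g x a)); pt.
Qed.

Lemma polytime_nth A (eA : Enc A) a (l : X -> seq A) (n : X -> nat) :
  polytime l -> polytime n -> polytime (fun x => nth a (l x) (n x)).
Proof.
move=> hl hn; apply: (polytime_ext (f := fun x => head a (iter (n x) behead (l x)))).
  by move=> x; rewrite -nth0; elim: (n x) (l x) => [|k IH] [|b s];
    rewrite ?iterSr //= ?IH ?nth_nil ?nth0.
apply: polytime_head; apply: (polytime_iter_grow (g := fun _ => behead) (K := fun=> 0)) => //.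
- by pt.
- exact: pb_const.
- by move=> _ [|b s] //=; rewrite sz_cons; lia.
Qed.

Lemma sz_le_all A (eA : Enc A) K (s : seq A) :
  (forall i a, i < size s -> sz (nth a s i) <= K) -> sz s <= size s * K.+1 + 1.
Proof.
elim: s => //= b s IH h; rewrite sz_cons.
have := h 0 b isT => /= hb; have := IH (fun i => h i.+1); lia.
Qed.

Lemma polytime_iota (n : X -> nat) : polytime n -> polytime (fun x => iota 0 (n x)).
Proof.
move=> hn.
pose st (p : nat * seq nat) := (p.1.+1, p.1 :: p.2).
have stE k : iter k st (0, [::]) = (k, rev (iota 0 k)).
  elim: k => // k IH; have e : iota 0 k.+1 = iota 0 k ++ [:: k].
    by rewrite -addn1 iotaD.
  by rewrite iterS IH e rev_cat.
apply: (polytime_ext (f := fun x => rev (iter (n x) st (0, [::])).2)).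
  by move=> x; rewrite stE revK.
apply: polytime_rev; apply: polytime_snd; have [d h] := polytime_sz hn.
(* The growth criterion does not apply: a round adds the size of the current counter, which is part
   of the accumulator. The closed form [stE] gives a bound quadratic in the length instead. *)
apply: (polytime_iter (g := fun _ => st)
  (S := fun m => (m.+2 ^ d + (m.+2 ^ d * (m.+2 ^ d).+1 + 1)).+1)) => //.
- by pt.
- by rewrite /st; pt.
- by pb.
- move=> x k le; rewrite stE sz_pair ltnS; have := h x; rewrite sz_nat => h'.
  apply: leq_add; first by rewrite sz_nat; lia.
  apply: leq_trans (@sz_le_all nat Enc_nat ((sz x).+2 ^ d) _ _) _.
    rewrite size_rev size_iota => i a lt.
    rewrite (set_nth_default 0) ?size_rev ?size_iota // nth_rev size_iota //.
    by rewrite nth_iota ?sz_nat; lia.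
  by rewrite size_rev size_iota leq_add2r leq_mul2r; apply/orP; right; lia.
Qed.

End Ops3.

Ltac pt_op ::= lazymatch goal with
  | |- polytime (fun x => negb (@?f x)) => apply: (polytime_negb (f := f))
  | |- polytime (fun x => andb (@?f x) (@?g x)) => apply: (polytime_andb (f := f) (g := g))
  | |- polytime (fun x => orb (@?f x) (@?g x)) => apply: (polytime_orb (f := f) (g := g))
  | |- polytime (fun x => addb (@?f x) (@?g x)) => apply: (polytime_addb (f := f) (g := g))
  | |- polytime (fun x => behead (@?f x)) => apply: (polytime_behead (f := f))
  | |- polytime (fun x => head ?a (@?f x)) => apply: (polytime_head a (f := f))
  | |- polytime (fun x => nilp (@?f x)) => apply: (polytime_nilp (f := f))
  | |- polytime (fun x => predn (@?f x)) => apply: (polytime_pred (f := f))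
  | |- polytime (fun x => eq_op (@?f x) 0) => apply: (polytime_eq0 (f := f))
  | |- polytime (fun x => subn (@?f x) (@?g x)) => apply: (polytime_subn (f := f) (g := g))
  | |- polytime (fun x => eq_op (@?f x) (@?g x)) => apply: (polytime_eqn (f := f) (g := g))
  | |- polytime (fun x => size (@?f x)) => apply: (polytime_size (f := f))
  | |- polytime (fun x => catrev (@?f x) (@?g x)) => apply: (polytime_catrev (f := f) (g := g))
  | |- polytime (fun x => rev (@?f x)) => apply: (polytime_rev (f := f))
  | |- polytime (fun x => cat (@?f x) (@?g x)) => apply: (polytime_cat (f := f) (g := g))
  | |- polytime (fun x => flatten (@?l x)) => apply: (polytime_flatten (l := l))
  | |- polytime (fun x => nth ?a (@?l x) (@?n x)) => apply: (polytime_nth a (l := l) (n := n))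
  | |- polytime (fun x => iota 0 (@?n x)) => apply: (polytime_iota (n := n))
  end.

(** * Binary arithmetic and fractions *)

(* Words are binary numbers, least significant bit first, possibly with leading
   zeros.  In [addw] and [leqw], [size (a ++ b)] rounds exhaust both words. *)
Definition add_step (s : bool * seq bool * seq bool * seq bool) :=
  let: (c, a, b, o) := s in
  let: (x, y) := (head false a, head false b) in
  (if x then y || c else y && c, behead a, behead b, x (+) y (+) c :: o).

Definition add_out (s : bool * seq bool * seq bool * seq bool) :=
  rev (s.1.1.1 :: s.2).

Definition addw (a b : seq bool) :=
  add_out (iter (size (a ++ b)) add_step (false, a, b, [::])).

(** [r] is the verdict on the lower bits; since bits come in increasing weight, a later pair of
    distinct bits overrides it. *)
Definition leqw_step (s : bool * seq bool * seq bool) :=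
  let: (r, a, b) := s in
  let: (x, y) := (head false a, head false b) in
  (if x then y && r else y || r, behead a, behead b).

Definition leqw (a b : seq bool) :=
  (iter (size (a ++ b)) leqw_step (true, a, b)).1.1.

(** Horner's scheme from the most significant bit of [a], where [false :: c] doubles [c]. *)
Definition mulw (a b : seq bool) :=
  foldl (fun c x => if x then addw (false :: c) b else false :: c) [::] (rev a).

Notation qfrac := (seq bool * seq bool)%type.

Definition add_qf (p q : qfrac) : qfrac :=
  (addw (mulw p.1 q.2) (mulw q.1 p.2), mulw p.2 q.2).
Definition mul_qf (p q : qfrac) : qfrac := (mulw p.1 q.1, mulw p.2 q.2).
Definition inv_qf (p : qfrac) : qfrac := (p.2, p.1).
Definition leq_qf (p q : qfrac) := leqw (mulw p.1 q.2) (mulw q.1 p.2).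

Arguments addw : simpl never.
Arguments mulw : simpl never.
Arguments leqw : simpl never.
Arguments add_qf : simpl never.
Arguments mul_qf : simpl never.
Arguments inv_qf : simpl never.
Arguments leq_qf : simpl never.

Lemma sz_behead A (eA : Enc A) (s : seq A) : sz (behead s) <= sz s.
Proof. by case: s => //= a s; rewrite sz_cons; lia. Qed.

Lemma polytime_addw0 : polytime (fun p : seq bool * seq bool => addw p.1 p.2).
Proof.
apply: (polytime_comp (g := add_out)); last by rewrite /add_out; pt.
apply: (polytime_iter_grow (g := fun _ => add_step) (K := fun=> 4)).
- by pt.
- by pt.
(* Pattern matching on the state is replaced with projections, which [pt] can traverse. *)
- apply: (polytime_ext (f := fun p : (seq bool * seq bool) * (bool * seq bool * seq bool *
  seq bool) =>
    let s := p.2 in let x := head false s.1.1.2 in let y := head false s.1.2 in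
    let c := s.1.1.1 in
    (if x then y || c else y && c, behead s.1.1.2, behead s.1.2, x (+) y (+) c :: s.2))).
    by case=> [? [[[? ?] ?] ?]].
  by pt.
- exact: pb_const.
- move=> _ [[[c a] b] o]; rewrite /add_step !sz_pair sz_cons.
  have := sz_behead Enc_bool a; have := sz_behead Enc_bool b.
  by case: (head false a); case: (head false b); case: c;
     rewrite /= /(sz true) /(sz false) /=; lia.
Qed.

Lemma polytime_leqw0 : polytime (fun p : seq bool * seq bool => leqw p.1 p.2).
Proof.
apply: polytime_fst; apply: polytime_fst.
apply: (polytime_iter_grow (g := fun _ => leqw_step) (K := fun=> 4)).
- by pt.
- by pt.
- apply: (polytime_ext (f := fun p : (seq bool * seq bool) * (bool * seq bool * seq bool) =>
    let s := p.2 in let x := head false s.1.2 in let y := head false s.2 in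
    let r := s.1.1 in
    (if x then y && r else y || r, behead s.1.2, behead s.2))).
    by case=> [? [[? ?] ?]].
  by pt.
- exact: pb_const.
- move=> _ [[r a] b]; rewrite /leqw_step !sz_pair.
  have := sz_behead Enc_bool a; have := sz_behead Enc_bool b.
  by case: (head false a); case: (head false b); case: r;
     rewrite /= /(sz true) /(sz false) /=; lia.
Qed.

(** Lengths add up, leading zeros being kept. This stays harmless in a product, where the same word
    [b] is added at each round. *)
Lemma size_addw a b : size (addw a b) = (size a + size b).+1.
Proof.
have h n s : size (iter n add_step s).2 = n + size s.2.
  elim: n => // n IH; rewrite iterS; move: IH.
  by case: (iter n add_step s) => [[[c a'] b'] o] /= ->.
by rewrite /addw /add_out size_rev /= h size_cat addn0.
Qed.

Section Arith.
Context {X : Type} {eX : Enc X}.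

Lemma polytime_addw (f g : X -> seq bool) : polytime f -> polytime g -> polytime (fun x =>
  addw (f x) (g x)).
Proof. by move=> hf hg; apply: polytime_app2 hf hg; exact: polytime_addw0. Qed.

Lemma polytime_leqw (f g : X -> seq bool) : polytime f -> polytime g -> polytime (fun x =>
  leqw (f x) (g x)).
Proof. by move=> hf hg; apply: polytime_app2 hf hg; exact: polytime_leqw0. Qed.

End Arith.

Lemma polytime_mulw0 : polytime (fun p : seq bool * seq bool => mulw p.1 p.2).
Proof.
apply: (polytime_foldl (g := fun p c x => if x then addw (false :: c) p.2 else false :: c)
  (S := fun n => 4 * (n * (n + 2)) + 1)).
- by pt.
- by pt.
- apply: polytime_if; [by pt| |by pt].
  by apply: polytime_addw; pt.
- by pb.
- move=> [a b] s1 s2 e.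
  (* Each bit of [a] lengthens the accumulator by at most [size b + 2]. The factor 4 in the
     announced bound is that of [sz_word]. *)
  have h (s : seq bool) :
      size (foldl (fun c x => if x then addw (false :: c) b else false :: c) [::] s)
        <= size s * (size b + 2).
    elim/last_ind: s => // s x IH; rewrite -cats1 foldl_cat size_cat /=.
    by case: x; rewrite ?size_addw /=; nia.
  apply: leq_trans (sz_word _) _; rewrite leq_add2r leq_mul2l /=.
  apply: leq_trans (h s1) _.
  have : size a = size s1 + size s2 by rewrite -size_cat -e size_rev.
  have := size_word_sz a; have := size_word_sz b.
  by rewrite sz_pair /=; nia.
Qed.

Section Arith2.
Context {X : Type} {eX : Enc X}.

Lemma polytime_mulw (f g : X -> seq bool) : polytime f -> polytime g -> polytime (fun x =>
  mulw (f x) (g x)).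
Proof. by move=> hf hg; apply: polytime_app2 hf hg; exact: polytime_mulw0. Qed.

Lemma polytime_add_qf (f g : X -> qfrac) : polytime f -> polytime g -> polytime (fun x =>
  add_qf (f x) (g x)).
Proof.
by move=> hf hg; apply: polytime_pair; [apply: polytime_addw|]; do ?apply: polytime_mulw; pt.
Qed.

Lemma polytime_mul_qf (f g : X -> qfrac) : polytime f -> polytime g -> polytime (fun x =>
  mul_qf (f x) (g x)).
Proof. by move=> hf hg; apply: polytime_pair; apply: polytime_mulw; pt. Qed.

Lemma polytime_inv_qf (f : X -> qfrac) : polytime f -> polytime (fun x => inv_qf (f x)).
Proof. by move=> hf; rewrite /inv_qf; pt. Qed.

Lemma polytime_leq_qf (f g : X -> qfrac) : polytime f -> polytime g -> polytime (fun x =>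
  leq_qf (f x) (g x)).
Proof. by move=> hf hg; apply: polytime_leqw; apply: polytime_mulw; pt. Qed.

End Arith2.

Lemma sz_fst A B (eA : Enc A) (eB : Enc B) (p : A * B) : sz p.1 <= sz p.
Proof. by case: p => a b; rewrite sz_pair /=; lia. Qed.

(** * Parsers *)

(** [X] is a context: the dimensions read beforehand, which fix the lengths of the tables. *)
Definition parser X A := X -> seq bool -> A * seq bool.

(** That the rest never gets longer is what bounds all entries of a table uniformly, whatever their
    position. *)
Definition polytime_parser {X A} {eX : Enc X} {eA : Enc A} (p : parser X A) :=
  polytime (fun q => p q.1 q.2) /\ forall x w, size (p x w).2 <= size w.

(** The length of the input serves as fuel; the boolean freezes the state once the terminator has
    been read. *)
Definition unary_step (s : bool * nat * seq bool) :=
  if s.1.1 then s else (~~ head false s.2, if head false s.2 then s.1.2.+1 else s.1.2,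
    behead s.2).

Definition p_unary {X} : parser X nat := fun _ w =>
  let s := iter (size w) unary_step (false, 0, w) in (s.1.2, s.2).

Definition bits_step (s : bool * seq bool * seq bool) :=
  if s.1.1 then s else
  if head false s.2 then (false, head false (behead s.2) :: s.1.2, behead (behead s.2))
  else (true, s.1.2, behead s.2).

Definition p_bits {X} : parser X (seq bool) := fun _ w =>
  let s := iter (size w) bits_step (false, [::], w) in (rev s.1.2, s.2).

Definition p_skip {X} : parser X unit := fun _ w => (tt, behead w).

Definition p_cat X A B (p : parser X A) (q : parser X B) : parser X (A * B) :=
  fun x w => let r := p x w in let s := q x r.2 in ((r.1, s.1), s.2).

Definition p_bind X A B (p : parser X A) (q : parser (X * A) B) : parser X (A * B) :=
  fun x w => let r := p x w in let s := q (x, r.1) r.2 in ((r.1, s.1), s.2).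

Definition p_option X A (p : parser X A) : parser X (option A) :=
  fun x w => if head false w then let r := p x (behead w) in (Some r.1, r.2)
             else (None, behead w).

Definition p_table X A (n : X -> nat) (p : parser X A) : parser X (seq A) :=
  fun x w => let s := iter (n x) (fun s => let r := p x s.2 in (r.1 :: s.1, r.2)) ([::], w) in
             (rev s.1, s.2).

Section Parsers.
Context {X : Type} {eX : Enc X}.

Lemma polytime_p_unary : polytime_parser (@p_unary X).
Proof.
split=> [|x w].
  apply: (polytime_comp (f := fun q : X * seq bool => iter (size q.2) unary_step (false, 0,
    q.2))
                  (g := fun s : bool * nat * seq bool => (s.1.2, s.2))); last by pt.
  apply: (polytime_iter_grow (g := fun _ => unary_step) (K := fun=> 4)).
  - by pt.
  - by pt.
  - by rewrite /unary_step; pt.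
  - exact: pb_const.
  - move=> _ [[b n] w]; rewrite /unary_step /=; case: b => //=; first by lia.
    have := sz_behead Enc_bool w.
    by case: (head false w); rewrite /= !sz_pair ?sz_succ /(sz true) /(sz false) /=; lia.
rewrite /p_unary /=; elim: {1}(size w) => // n IH; rewrite iterS.
apply: leq_trans IH; case: (iter _ _ _) => [[b m] u]; rewrite /unary_step /=.
by case: b => //=; rewrite size_behead; lia.
Qed.

Lemma polytime_p_bits : polytime_parser (@p_bits X).
Proof.
split=> [|x w].
  apply: (polytime_comp (f := fun q : X * seq bool => iter (size q.2) bits_step (false, [::],
    q.2))
                  (g := fun s : bool * seq bool * seq bool => (rev s.1.2, s.2))); last by pt.
  apply: (polytime_iter_grow (g := fun _ => bits_step) (K := fun=> 8)).
  - by pt.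
  - by pt.
  - by rewrite /bits_step; pt.
  - exact: pb_const.
  - move=> _ [[b n] w]; rewrite /bits_step /=; case: b => //=; first by lia.
    have := sz_behead Enc_bool w; have := sz_behead Enc_bool (behead w).
    have := sz_bool (head false (behead w)).
    by case: (head false w); rewrite /= !sz_pair ?sz_cons /(sz true) /(sz false) /=; lia.
rewrite /p_bits /=; elim: {1}(size w) => // n IH; rewrite iterS.
apply: leq_trans IH; case: (iter _ _ _) => [[b m] u]; rewrite /bits_step /=.
by case: b => //=; case: (head _ _) => /=; rewrite !size_behead; lia.
Qed.

Lemma polytime_p_skip : polytime_parser (@p_skip X).
Proof. by split=> [|x w]; [rewrite /p_skip; pt|rewrite /= size_behead; lia]. Qed.

Lemma polytime_p_cat A B (eA : Enc A) (eB : Enc B) (p : parser X A) (q : parser X B) :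
  polytime_parser p -> polytime_parser q -> polytime_parser (p_cat p q).
Proof.
case=> hp sp [hq sq]; split=> [|x w] /=; last exact: leq_trans (sq _ _) (sp _ _).
have h : polytime (fun y : X * seq bool => q y.1 (p y.1 y.2).2).
  apply: (polytime_comp (f := fun y : X * seq bool => (y.1, (p y.1 y.2).2)) _ hq).
  by pt.
by rewrite /p_cat; pt.
Qed.

Lemma polytime_p_bind A B (eA : Enc A) (eB : Enc B) (p : parser X A) (q : parser (X * A) B) :
  polytime_parser p -> polytime_parser q -> polytime_parser (p_bind p q).
Proof.
case=> hp sp [hq sq]; split=> [|x w] /=; last exact: leq_trans (sq _ _) (sp _ _).
have h : polytime (fun y : X * seq bool => q (y.1, (p y.1 y.2).1) (p y.1 y.2).2).
  apply: (polytime_comp (f := fun y : X * seq bool => ((y.1, (p y.1 y.2).1),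
    (p y.1 y.2).2)) _ hq).
  by pt.
by rewrite /p_bind; pt.
Qed.

Lemma polytime_p_option A (eA : Enc A) (p : parser X A) :
  polytime_parser p -> polytime_parser (p_option p).
Proof.
case=> hp sp; split=> [|x w] /=; last first.
  rewrite /p_option; case: (head _ _) => /=; last by rewrite size_behead; lia.
  by apply: leq_trans (sp _ _) _; rewrite size_behead; lia.
have h : polytime (fun y : X * seq bool => p y.1 (behead y.2)).
  by apply: (polytime_comp (f := fun y : X * seq bool => (y.1, behead y.2)) _ hp); pt.
by rewrite /p_option; apply: polytime_if; pt.
Qed.

Lemma polytime_p_table A (eA : Enc A) (n : X -> nat) (p : parser X A) :
  polytime n -> polytime_parser p -> polytime_parser (p_table n p).
Proof.
move=> hn [hp sp].
pose st x (s : seq A * seq bool) := let r := p x s.2 in (r.1 :: s.1, r.2).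
have size_st x w k : size (iter k (st x) ([::], w)).2 <= size w.
  by elim: k => //= k IH; apply: leq_trans (sp _ _) IH.
split=> [|x w] /=; last exact: size_st.
apply: (polytime_comp (f := fun y : X * seq bool => iter (n y.1) (st y.1) ([::], y.2))
                (g := fun s => (rev s.1, s.2))); last by pt.
have [d h] := polytime_sz hp; have [e h'] := polytime_sz hn.
apply: (polytime_iter (g := fun y => st y.1)
  (S := fun m => (m.+2 ^ e * ((m + (4 * m + 1)).+1.+2 ^ d).+1 + 1 + (4 * m + 1)).+1)).
- by apply: polytime_comp hn; pt.
- by pt.
- have h1 : polytime (fun q : (X * seq bool) * (seq A * seq bool) => p q.1.1 q.2.2).
    by apply: (polytime_comp (f := fun q : (X * seq bool) * (seq A * seq bool) =>
      (q.1.1, q.2.2)) _ hp); pt.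
  by rewrite /st; pt.
- by pb.
- move=> [x w] k /= le.
  have szm : sz (iter k (st x) ([::], w)).2 <= 4 * sz (x, w) + 1.
    apply: leq_trans (sz_word _) _; have := size_st x w k; have := size_word_sz w.
    by rewrite sz_pair; lia.
  (* For an arbitrary accumulator the increment has no bound in terms of the input. Along this
     iteration, however, the rest is never longer than [w], so every entry obeys the same bound. *)
  have szl : sz (iter k (st x) ([::], w)).1 <=
      k * ((sz (x, w) + (4 * sz (x, w) + 1)).+1.+2 ^ d).+1 + 1.
    elim: k {le szm} => // k IH; rewrite iterS sz_cons mulSn.
    have : sz (p x (iter k (st x) ([::], w)).2).1 <=
        (sz (x, w) + (4 * sz (x, w) + 1)).+1.+2 ^ d.
      apply: leq_trans (sz_fst _ _ _) _.
      apply: leq_trans (h (x, (iter k (st x) ([::], w)).2)) _.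
      apply: leq_pow2; rewrite sz_pair ltnS.
      apply: leq_add; first by rewrite sz_pair; lia.
      apply: leq_trans (sz_word _) _; have := size_st x w k; have := size_word_sz w.
      by rewrite sz_pair; lia.
    by lia.
  case: (iter k (st x) _) szm szl => u v /= szm szl; rewrite sz_pair ltnS.
  apply: leq_add szm; apply: leq_trans szl _; rewrite leq_add2r leq_mul2r; apply/orP; right.
  apply: leq_trans le _; have := h' x; rewrite sz_nat => le2.
  have : (sz x).+2 ^ e <= (sz (x, w)).+2 ^ e by apply: leq_pow2; rewrite sz_pair; lia.
  by lia.
Qed.

Definition p_rat : parser X qfrac := p_cat p_bits p_bits.

Lemma polytime_p_rat : polytime_parser p_rat.
Proof. by apply: polytime_p_cat; apply: polytime_p_bits. Qed.

End Parsers.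

(** * The algorithm *)

Notation dims := (nat * (nat * (nat * nat)))%type.
Notation tier := (qfrac * (qfrac * (qfrac * unit)))%type.
Notation part := (qfrac * (qfrac * (qfrac * (option nat * (option nat *
  seq (qfrac * qfrac))))))%type.
Notation body := (qfrac * (qfrac * (qfrac * (qfrac * (nat * (seq tier * (seq qfrac *
  (seq (seq qfrac) * seq part))))))))%type.
Notation data := (dims * body)%type.

Definition p_dims {X} : parser X dims :=
  p_cat p_unary (p_cat p_unary (p_cat p_unary p_unary)).

Definition p_tier {X} : parser X tier := p_cat p_rat (p_cat p_rat (p_cat p_rat p_skip)).

Definition p_part {X} (nK : X -> nat) : parser X part :=
  p_cat p_rat (p_cat p_rat (p_cat p_rat (p_cat (p_option p_unary)
    (p_cat (p_option p_unary) (p_table nK (p_cat p_rat p_rat)))))).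

Definition p_body {X} (nL nN nK : X -> nat) : parser X body :=
  p_cat p_rat (p_cat p_rat (p_cat p_rat (p_cat p_rat (p_cat p_unary
    (p_cat (p_table nL p_tier) (p_cat (p_table nL p_rat)
      (p_cat (p_table nL (p_table nL p_rat)) (p_table nN (p_part nK))))))))).

Definition p_data : parser unit data :=
  p_bind p_dims
    (p_body (fun y => y.2.1) (fun y => y.2.2.1) (fun y => y.2.2.2.2)).

Ltac ptp := repeat first [exact: polytime_p_unary | exact: polytime_p_rat | exact:
  polytime_p_skip
  | apply: polytime_p_cat | apply: polytime_p_option | apply: polytime_p_table; [by pt|] ].

Lemma polytime_p_data : polytime_parser p_data.
Proof.
apply: polytime_p_bind; first by rewrite /p_dims; ptp.
by rewrite /p_body /p_tier /p_part; ptp.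
Qed.

Definition read_instance (w : seq bool) : data := (p_data tt w).1.

Lemma polytime_read_instance X (eX : Enc X) (w : X -> seq bool) : polytime w ->
  polytime (fun x => read_instance (w x)).
Proof.
move=> hw; apply: polytime_fst; have [h _] := polytime_p_data.
by apply: (polytime_comp (f := fun x => (tt, w x)) _ h); pt.
Qed.

(** Default value for positions out of range, with denominator 0; it is never read on the data of an
    instance. *)
Definition zeroq : qfrac := ([::], [::]).
Definition tier0 : tier := (zeroq, (zeroq, (zeroq, tt))).

Notation dim_L d := d.1.1.
Notation dim_K d := d.1.2.2.2.
Notation alpha_of d := d.2.1.
Notation beta_of d := d.2.2.1.
Notation gamma_of d := d.2.2.2.1.
Notation compute_of d := d.2.2.2.2.1.
Notation tiers_of d := d.2.2.2.2.2.2.1.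
Notation new_of d := d.2.2.2.2.2.2.2.1.
Notation change_of d := d.2.2.2.2.2.2.2.2.1.
Notation parts_of d := d.2.2.2.2.2.2.2.2.2.
Notation span_of p := p.1.
Notation accesses_of p := p.2.1.
Notation threshold_of p := p.2.2.1.
Notation tier_of p := p.2.2.2.1.
Notation scheme_of p := p.2.2.2.2.1.
Notation options_of p := p.2.2.2.2.2.

Definition scheme_ok (o : option nat) k := if o is Some k0 then k == k0 else true.

Definition change_qf (new : seq qfrac) (change : seq (seq qfrac)) (o : option nat) l :=
  if o is Some u then nth zeroq (nth [::] change u) l else nth zeroq new l.

Definition nth_tier (d : data) l := nth tier0 (tiers_of d) l.
Definition nth_option (p : part) k := nth (zeroq, zeroq) (options_of p) k.

Definition allowed (e : data * part) (c : nat * nat) : bool :=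
  scheme_ok (scheme_of e.2) c.2 &&
  leq_qf (add_qf (nth_option e.2 c.2).2 (nth_tier e.1 c.1).2.2.1) (threshold_of e.2).

Definition cost_qf (e : data * part) (c : nat * nat) : qfrac :=
  let d := e.1 in let p := e.2 in
  let t := nth_tier d c.1 in let o := nth_option p c.2 in
  let size := mul_qf (span_of p) (inv_qf o.1) in
  add_qf
    (mul_qf (add_qf (mul_qf (alpha_of d) t.1)
                (mul_qf (gamma_of d)
                   (change_qf (new_of d) (change_of d) (tier_of p) c.1)))
          size)
    (mul_qf (mul_qf (beta_of d) (accesses_of p))
          (add_qf (mul_qf (compute_of d) o.2) (mul_qf t.2.1 size))).

Definition better (e : data * part) (b : option (nat * nat)) (c : nat * nat) :=
  if b is Some c0 then
    if leq_qf (cost_qf e c0) (cost_qf e c) then Some c0 else Some c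
  else Some c.

Definition candidates (e : data * part) : seq (nat * nat) :=
  [seq c <- flatten [seq [seq (l, k) | k <- iota 0 (dim_K e.1)] | l <- iota 0 (dim_L e.1)]
   | allowed e c].

Definition best (e : data * part) := foldl (better e) None (candidates e).

Definition is_choice (b : option (nat * nat)) l k :=
  if b is Some c then (l == c.1) && (k == c.2) else false.

Definition choice_row (d : data) (p : part) : seq bool :=
  flatten [seq [seq is_choice (best (d, p)) l k | k <- iota 0 (dim_K d)]
          | l <- iota 0 (dim_L d)].

Definition answer (d : data) : seq bool :=
  if all (fun p => isSome (best (d, p))) (parts_of d)
  then true :: flatten [seq choice_row d p | p <- parts_of d] else [:: false].

Arguments cost_qf : simpl never.
Arguments allowed : simpl never.

Lemma polytime_scheme_ok X (eX : Enc X) (o : X -> option nat) (k : X -> nat) :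
  polytime o -> polytime k -> polytime (fun x => scheme_ok (o x) (k x)).
Proof.
move=> ho hk; apply: (polytime_match_option (g := fun x k0 => k x == k0)) => //; first by pt.
by pt; apply: polytime_comp hk; pt.
Qed.

Lemma polytime_change_qf X (eX : Enc X) (new : X -> seq qfrac) (change : X -> seq (seq qfrac))
    (o : X -> option nat) (l : X -> nat) :
  polytime new -> polytime change -> polytime o -> polytime l ->
  polytime (fun x => change_qf (new x) (change x) (o x) (l x)).
Proof.
move=> hn hc ho hl.
apply: (polytime_match_option (g := fun x u => nth zeroq (nth [::] (change x) u) (l x))) => //.
  by pt.
have h1 : polytime (fun p : X * nat => p.1) by pt.
by pt; [exact: polytime_comp h1 hc|exact: polytime_comp h1 hl].
Qed.

Lemma polytime_nth_tier X (eX : Enc X) (d : X -> data) (l : X -> nat) :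
  polytime d -> polytime l -> polytime (fun x => nth_tier (d x) (l x)).
Proof. by move=> hd hl; rewrite /nth_tier; pt. Qed.

Lemma polytime_nth_option X (eX : Enc X) (p : X -> part) (k : X -> nat) :
  polytime p -> polytime k -> polytime (fun x => nth_option (p x) (k x)).
Proof. by move=> hp hk; rewrite /nth_option; pt. Qed.

Ltac pt_op ::= lazymatch goal with
  | |- polytime (fun x => negb (@?f x)) => apply: (polytime_negb (f := f))
  | |- polytime (fun x => andb (@?f x) (@?g x)) => apply: (polytime_andb (f := f) (g := g))
  | |- polytime (fun x => orb (@?f x) (@?g x)) => apply: (polytime_orb (f := f) (g := g))
  | |- polytime (fun x => addb (@?f x) (@?g x)) => apply: (polytime_addb (f := f) (g := g))
  | |- polytime (fun x => behead (@?f x)) => apply: (polytime_behead (f := f))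
  | |- polytime (fun x => head ?a (@?f x)) => apply: (polytime_head a (f := f))
  | |- polytime (fun x => nilp (@?f x)) => apply: (polytime_nilp (f := f))
  | |- polytime (fun x => predn (@?f x)) => apply: (polytime_pred (f := f))
  | |- polytime (fun x => eq_op (@?f x) 0) => apply: (polytime_eq0 (f := f))
  | |- polytime (fun x => subn (@?f x) (@?g x)) => apply: (polytime_subn (f := f) (g := g))
  | |- polytime (fun x => eq_op (@?f x) (@?g x)) => apply: (polytime_eqn (f := f) (g := g))
  | |- polytime (fun x => size (@?f x)) => apply: (polytime_size (f := f))
  | |- polytime (fun x => catrev (@?f x) (@?g x)) => apply: (polytime_catrev (f := f) (g := g))
  | |- polytime (fun x => rev (@?f x)) => apply: (polytime_rev (f := f))
  | |- polytime (fun x => cat (@?f x) (@?g x)) => apply: (polytime_cat (f := f) (g := g))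
  | |- polytime (fun x => flatten (@?l x)) => apply: (polytime_flatten (l := l))
  | |- polytime (fun x => iota 0 (@?n x)) => apply: (polytime_iota (n := n))
  | |- polytime (fun x => nth_tier (@?d x) (@?l x)) => apply: (polytime_nth_tier (d :=
    d) (l := l))
  | |- polytime (fun x => nth_option (@?p x) (@?k x)) => apply: (polytime_nth_option (p :=
    p) (k := k))
  | |- polytime (fun x => scheme_ok (@?o x) (@?k x)) => apply: (polytime_scheme_ok (o :=
    o) (k := k))
  | |- polytime (fun x => change_qf (@?a x) (@?b x) (@?c x) (@?d x)) =>
      apply: (polytime_change_qf (new := a) (change := b) (o := c) (l := d))
  | |- polytime (fun x => add_qf (@?f x) (@?g x)) => apply: (polytime_add_qf (f := f) (g := g))
  | |- polytime (fun x => mul_qf (@?f x) (@?g x)) => apply: (polytime_mul_qf (f := f) (g := g))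
  | |- polytime (fun x => inv_qf (@?f x)) => apply: (polytime_inv_qf (f := f))
  | |- polytime (fun x => leq_qf (@?f x) (@?g x)) => apply: (polytime_leq_qf (f := f) (g := g))
  end.

Lemma polytime_allowed : polytime (fun q : (data * part) * (nat * nat) => allowed q.1 q.2).
Proof. by rewrite /allowed; pt. Qed.

Lemma polytime_cost_qf X (eX : Enc X) (e : X -> data * part) (c : X -> nat * nat) :
  polytime e -> polytime c -> polytime (fun x => cost_qf (e x) (c x)).
Proof. by move=> he hc; rewrite /cost_qf; pt. Qed.

Lemma polytime_candidates : polytime candidates.
Proof.
apply: (polytime_filter (g := allowed)); first exact: polytime_allowed.
apply: polytime_flatten.
apply: (polytime_map (g := fun (e : data * part) l => [seq (l,
  k) | k <- iota 0 (dim_K e.1)])); last by pt.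
by apply: (polytime_map (g := fun (y : (data * part) * nat) k => (y.2, k))); pt.
Qed.

Lemma sz_nth_le A (eA : Enc A) a (s : seq A) i : i < size s -> sz (nth a s i) <= sz s.
Proof.
elim: s i => // b s IH [|i] /=; rewrite sz_cons; first by lia.
by rewrite ltnS => /IH; lia.
Qed.

(** Serves twice: membership bounds the size of the accumulator by that of the list, and it makes
    the selected pair admissible. *)
Lemma best_mem e s :
  if foldl (better e) None s is Some c then is_true (c \in s) else s = [::].
Proof.
elim/last_ind: s => // s c; set b := foldl (better e) None s => hb.
rewrite -cats1 foldl_cat -/b.
case: b hb => [c0|->]; last by rewrite /= mem_seq1.
move=> h; rewrite /foldl /better.
by case: ifP => _; rewrite mem_cat ?h // mem_seq1 eqxx orbT.
Qed.

Lemma polytime_best X (eX : Enc X) (e : X -> data * part) : polytime e -> polytime (fun x =>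
  best (e x)).
Proof.
move=> he; apply: (polytime_comp (g := best) he).
have [d h] := polytime_sz polytime_candidates.
apply: (polytime_foldl (g := better) (l := candidates) (S := fun n => (n.+2 ^ d).+2)).
- exact: polytime_candidates.
- by pt.
- apply: (polytime_match_option (g := fun (q : (data * part) * option (nat * nat) * (nat *
  nat)) c0 =>
    if leq_qf (cost_qf q.1.1 c0) (cost_qf q.1.1 q.2) then Some c0 else Some q.2)); first by pt.
    by pt.
  apply: polytime_if; [|by pt|by pt].
  by apply: polytime_leq_qf; apply: polytime_cost_qf; pt.
- by pb.
- move=> x s1 s2 es; have := best_mem x s1; case: (foldl _ _ s1) => [c|] // /(nthP c)[i lt <-].
  rewrite sz_Some !ltnS; apply: leq_trans (h x); rewrite es.
  have := sz_cat (Enc_prod Enc_nat Enc_nat) s1 s2.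
  have := sz_gt0 (Enc_seq (Enc_prod Enc_nat Enc_nat)) s2.
  by move=> h2 h1; apply: leq_trans (sz_nth_le (Enc_prod Enc_nat Enc_nat) c lt) _; lia.
Qed.

Lemma polytime_answer : polytime answer.
Proof.
apply: polytime_if; last by pt.
  apply: (polytime_all (g := fun (d : data) p => isSome (best (d, p)))); last by pt.
  apply: (polytime_match_option (o := fun q : data * part => best (q.1, q.2))
    (f := fun=> false) (g := fun _ _ => true)); [|by pt|by pt].
  by apply: polytime_best; pt.
apply: polytime_cons; first by pt.
apply: polytime_flatten; apply: (polytime_map (g := choice_row)); last by pt.
apply: polytime_flatten.
apply: (polytime_map (g := fun (q : data * part) l =>
  [seq is_choice (best (q.1, q.2)) l k | k <- iota 0 (dim_K q.1)])); last by pt.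
apply: (polytime_map (g := fun (y : (data * part) * nat) k => is_choice (best (y.1.1,
  y.1.2)) y.2 k)); last by pt.
apply: (polytime_match_option (o := fun z : (data * part) * nat * nat => best (z.1.1.1,
  z.1.1.2))
   (f := fun=> false) (g := fun z c => (z.1.2 == c.1) && (z.2 == c.2))); [|by pt|by pt].
by apply: polytime_best; pt.
Qed.

Definition solve (w : seq bool) : seq bool := answer (read_instance w).

Lemma polytime_solve : polytime solve.
Proof. by apply: polytime_comp polytime_answer; apply: polytime_read_instance; pt. Qed.

(** * Correctness *)

Definition wval (w : seq bool) : nat := foldr (fun (b : bool) n => b + n.*2) 0 w.

Lemma wval_behead w : wval w = head false w + (wval (behead w)).*2.
Proof. by case: w. Qed.

Lemma wval_cat u v : wval (u ++ v) = wval u + 2 ^ size u * wval v.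
Proof.
elim: u => [|b u IH] /=; first by rewrite mul1n.
by rewrite IH expnS doubleD addnA -!mul2n mulnA.
Qed.

Lemma wval_rev_cons b w : wval (rev (b :: w)) = wval (rev w) + 2 ^ size w * b.
Proof. by rewrite rev_cons -cats1 wval_cat size_rev /= addn0. Qed.

Lemma iter_behead (T : Type) n (s : seq T) : size s <= n -> iter n behead s = [::].
Proof.
elim: n s => [|n IH] [|a s] //; rewrite iterSr /=; last exact: IH.
by move=> _; rewrite IH.
Qed.

Lemma wval_addw a b : wval (addw a b) = wval a + wval b.
Proof.
rewrite /addw /add_out; set n := size _.
(* Invariant: the bits already output, plus the carry and both remaining words at the weight of the
   next bit, amount to the total. *)
have fields k : let s := iter k add_step (false, a, b, [::]) in
    [/\ s.1.1.2 = iter k behead a, s.1.2 = iter k behead b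
      & wval (rev s.2) + 2 ^ size s.2 * (s.1.1.1 + wval s.1.1.2 + wval s.1.2)
        = wval a + wval b].
  elim: k => [|k] /=; first by rewrite mul1n.
  case: (iter k add_step _) => [[[c u] v] o] /= [-> -> <-]; split=> //.
  rewrite wval_rev_cons expnS (wval_behead (iter k behead a)).
  rewrite (wval_behead (iter k behead b)) -addnA; congr addn.
  rewrite -mulnA mulnCA -mulnDr; congr muln.
  by case: (head _ _); case: (head _ _); case: c => /=; lia.
have [ea eb <-] := fields n.
have le : size a <= n /\ size b <= n by rewrite /n size_cat; lia.
by rewrite ea eb !iter_behead ?wval_rev_cons //=; first lia; case: le.
Qed.

Lemma leqwE a b : leqw a b = (wval a <= wval b).
Proof.
(* The initial flag is kept general: it stands for the lower bits already read, and decides only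
   when the remaining words have equal values. *)
have h n r u v : size u <= n -> size v <= n ->
    (iter n leqw_step (r, u, v)).1.1 =
    if wval u == wval v then r else wval u < wval v.
  elim: n r u v => [|n IH] r u v; first by case: u; case: v.
  move=> lu lv; rewrite iterSr IH ?size_behead; [|lia|lia].
  rewrite (wval_behead u) (wval_behead v).
  move: (wval (behead u)) (wval (behead v)) => p q.
  case: (head _ _); case: (head _ _); case: r => /=; do !case: eqP => //; lia.
rewrite /leqw h ?size_cat; [|lia|lia].
by case: eqP => [->|]; lia.
Qed.

Lemma wval_mulw a b : wval (mulw a b) = wval a * wval b.
Proof.
rewrite /mulw foldl_rev; elim: a => //= x a IH.
by case: x; rewrite ?wval_addw /= IH; lia.
Qed.

Lemma wval_bits n : wval (bits_of_nat n) = n.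
Proof.
(* The number of bits is freed from [m], so that halving [m] fits the induction on [k]. *)
have h k m : m < 2 ^ k -> wval (mkseq (fun i => odd (m %/ 2 ^ i)) k) = m.
  elim: k m => [|k IH] m lt; first by case: m lt.
  rewrite /mkseq -[k.+1]add1n iotaD map_cat /= divn1.
  have -> : [seq odd (m %/ 2 ^ i) | i <- iota 1 k] =
            mkseq (fun i => odd (m./2 %/ 2 ^ i)) k.
    rewrite -[1]addn0 iotaDl -map_comp; apply: eq_map => i /=.
    by rewrite add1n expnS divnMA divn2.
  by rewrite IH; move: lt; rewrite ?expnS; lia.
by apply: h; apply: up_logP.
Qed.

Import Order.TTheory GRing.Theory Num.Theory.
Local Open Scope ring_scope.

(** * Fractions as rationals *)

Definition qval (p : qfrac) : rat := (wval p.1)%:R / (wval p.2)%:R.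
Definition pos_den (p : qfrac) := (0 < wval p.2)%N.

Lemma pos_den_neq0 p : pos_den p -> (wval p.2)%:R != 0 :> rat.
Proof. by rewrite pnatr_eq0 -lt0n. Qed.

Lemma qval_add p q : pos_den p -> pos_den q ->
  qval (add_qf p q) = qval p + qval q /\ pos_den (add_qf p q).
Proof.
move=> hp hq; split; last by rewrite /pos_den wval_mulw muln_gt0; apply/andP.
by rewrite /qval addf_div ?pos_den_neq0 //= wval_addw !wval_mulw natrD !natrM.
Qed.

Lemma qval_mul p q : pos_den p -> pos_den q ->
  qval (mul_qf p q) = qval p * qval q /\ pos_den (mul_qf p q).
Proof.
move=> hp hq; split; last by rewrite /pos_den wval_mulw muln_gt0; apply/andP.
by rewrite /qval mulf_div /= !wval_mulw !natrM.
Qed.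

(** A positive value forces a nonzero numerator, which becomes the denominator of the inverse. *)
Lemma qval_inv p : 0 < qval p -> qval (inv_qf p) = (qval p)^-1 /\ pos_den (inv_qf p).
Proof.
move=> hp; split; first by rewrite /qval /= invf_div.
by rewrite /pos_den /= lt0n; apply: contraTN hp => /eqP e; rewrite /qval e mul0r ltxx.
Qed.

Lemma leq_qfE p q : pos_den p -> pos_den q -> leq_qf p q = (qval p <= qval q).
Proof.
move=> hp hq; rewrite /leq_qf leqwE !wval_mulw /qval.
rewrite ler_pdivrMr ?ltr0n // mulrAC ler_pdivlMr ?ltr0n //.
by rewrite -!natrM ler_nat.
Qed.

Definition frac_of (r : rat) : qfrac := (bits_of_nat `|numq r|, bits_of_nat `|denq r|).

Lemma qval_frac_of r : 0 <= r -> qval (frac_of r) = r /\ pos_den (frac_of r).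
Proof.
move=> r0; rewrite /qval /pos_den /= !wval_bits; split; last by rewrite absz_gt0.
rewrite -[RHS]divq_num_den !pmulrn !gez0_abs ?numq_ge0 //.
Qed.

Local Close Scope ring_scope.

(** The arbitrary continuation [r] says that the codes are self-delimiting, which is what makes
    their concatenations readable. *)
Definition parses X A (p : parser X A) x w a := forall r, p x (w ++ r) = (a, r).

Lemma parses_unary X x n : parses (@p_unary X) x (enc_unary n) n.
Proof.
move=> r; rewrite /p_unary /enc_unary -cats1 -catA /=.
have halt k m u : iter k unary_step (true, m, u) = (true, m, u).
  by elim: k => //= k ->.
(* The code and its terminator take [n.+1] rounds; the other [j] rounds of fuel act on a frozen
   state. *)
have run m j : iter (n.+1 + j) unary_step (false, m, nseq n true ++ false :: r)
             = (true, m + n, r).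
  elim: n m => [|n IH] m; first by rewrite iterSr /= addn0 halt.
  by rewrite addSn iterSr -addSnnS; apply: IH.
by rewrite size_cat size_nseq /= -addSnnS run.
Qed.

Lemma parses_bits X x n : parses (@p_bits X) x (enc_nat n) (bits_of_nat n).
Proof.
move=> r; rewrite /p_bits /enc_nat -cats1 -catA /=.
set w := bits_of_nat n.
have halt k m u : iter k bits_step (true, m, u) = (true, m, u).
  by elim: k => //= k ->.
have run (u : seq bool) m j :
    iter ((size u).+1 + j) bits_step
      (false, m, flatten [seq [:: true; b] | b <- u] ++ false :: r)
    = (true, catrev u m, r).
  elim: u m => [|b u IH] m; first by rewrite iterSr /= halt.
  by rewrite addSn iterSr; apply: IH.
have le : (size w).+1 <= size (flatten [seq [:: true; b] | b <- w] ++ false :: r).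
  by rewrite size_cat /=; elim: (w) => //= b u IH; lia.
by rewrite -(subnKC le) run /= -/(rev w) revK.
Qed.

Lemma parses_cat X A B (p : parser X A) (q : parser X B) x u a v b :
  parses p x u a -> parses q x v b -> parses (p_cat p q) x (u ++ v) (a, b).
Proof. by move=> hp hq r; rewrite /p_cat -catA hp /= hq. Qed.

Lemma parses_bind X A B (p : parser X A) (q : parser (X * A) B) x u a v b :
  parses p x u a -> parses q (x, a) v b -> parses (p_bind p q) x (u ++ v) (a, b).
Proof. by move=> hp hq r; rewrite /p_bind -catA hp /= hq. Qed.

Lemma parses_rat X x r : parses (@p_rat X) x (enc_rat r) (frac_of r).
Proof. by apply: parses_cat; apply: parses_bits. Qed.

Lemma parses_ord X x n (i : 'I_n) : parses (@p_unary X) x (enc_ord i) i.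
Proof. exact: parses_unary. Qed.

Lemma parses_option X A B (p : parser X A) x (enc : B -> word) (g : B -> A) o :
  (forall b, parses p x (enc b) (g b)) ->
  parses (p_option p) x (enc_option enc o) (omap g o).
Proof. by move=> h r; case: o => [b|] //=; rewrite /p_option /= h. Qed.

Lemma parses_table X A (p : parser X A) x (n : X -> nat) m (f : 'I_m -> word) g :
  n x = m -> (forall i, parses p x (f i) (g i)) ->
  parses (p_table n p) x (enc_table f) [seq g i | i <- enum 'I_m].
Proof.
move=> nx h r; rewrite /p_table nx -[X in iter X](size_enum_ord m) /enc_table.
set st := fun _ => _.
have run (s : seq 'I_m) u :
    iter (size s) st (u, flatten [seq f i | i <- s] ++ r) = (catrev [seq g i | i <- s] u, r).
  elim: s u => // i s IH u; rewrite iterSr [st _]/st /= -catA h /=; exact: IH.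
by rewrite run /= -/(rev _) revK.
Qed.

Definition instance_data (P : instance) : data :=
  ((nL P, (nN P, (nI P, nK P))),
   (frac_of (alpha P), (frac_of (beta P), (frac_of (gamma P),
   (frac_of (compute_cost P), (nat_of_ord (no_compression P),
   ([seq (frac_of (storage_cost l), (frac_of (read_cost l),
          (frac_of (read_latency l), tt))) | l <- enum 'I_(nL P)],
   ([seq frac_of (change_cost None l) | l <- enum 'I_(nL P)],
   ([seq [seq frac_of (change_cost (Some u) l) | l <- enum 'I_(nL P)]
     | u <- enum 'I_(nL P)],
    [seq (frac_of (part_span n), (frac_of (accesses n), (frac_of (threshold n),
         (omap (@nat_of_ord _) (cur_tier n), (omap (@nat_of_ord _) (cur_scheme n),
         [seq (frac_of (comp_ratio n k), frac_of (decomp_time n k))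
         | k <- enum 'I_(nK P)])))))
    | n <- enum 'I_(nN P)]))))))))).

Lemma read_enc_instance P : no_capacity_constraints P ->
  read_instance (enc_instance P) = instance_data P.
Proof.
move=> cap; rewrite /read_instance.
suff h : parses p_data tt (enc_instance P) (instance_data P).
  by rewrite -[enc_instance P]cats0 h.
(* The four dimensions are grouped into one prefix, read by [p_bind] before the tables whose lengths
   they fix. *)
rewrite /enc_instance (catA (enc_unary (nI P))) (catA (enc_unary (nN P))).
rewrite (catA (enc_unary (nL P))).
apply: parses_bind; first by do 3?apply: parses_cat; apply: parses_unary.
do 4?[apply: parses_cat; first exact: parses_rat].
apply: parses_cat; first exact: parses_ord.
apply: parses_cat.
  apply: parses_table => // l; do 3?[apply: parses_cat; first exact: parses_rat].
  (* An infinite capacity is written as a single bit, exactly what [p_skip] drops. *)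
  by rewrite cap.
apply: parses_cat; first by apply: parses_table => // l; apply: parses_rat.
apply: parses_cat.
  by apply: parses_table => // u; apply: parses_table => // l; apply: parses_rat.
apply: parses_table => // n; do 3?[apply: parses_cat; first exact: parses_rat].
do 2?[apply: parses_cat; first by apply: parses_option; apply: parses_ord].
by apply: parses_table => // k; apply: parses_cat; apply: parses_rat.
Qed.

Local Open Scope ring_scope.

(** * Optimality of the independent choices *)

Lemma nth_map_enum_ord (T : Type) d m (g : 'I_m -> T) (i : 'I_m) :
  nth d [seq g j | j <- enum 'I_m] i = g i.
Proof. by rewrite (nth_map i) ?size_enum_ord // nth_ord_enum. Qed.

Lemma sum_choose m n (F : 'I_m -> 'I_n -> rat) (y : 'I_m -> 'I_n -> bool) i0 j0 :
  (forall i j, y i j = (i == i0) && (j == j0)) ->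
  \sum_i \sum_j F i j * (y i j)%:R = F i0 j0.
Proof.
move=> hy; rewrite (bigD1 i0) //= [X in _ + X]big1 ?addr0 => [|i ne]; last first.
  by rewrite big1 // => j _; rewrite hy (negbTE ne) mulr0.
rewrite (bigD1 j0) //= big1 ?addr0 => [|j ne]; first by rewrite hy !eqxx mulr1.
by rewrite hy (negbTE ne) andbF mulr0.
Qed.

Lemma sum_choose_nat m n (y : 'I_m -> 'I_n -> bool) i0 j0 :
  (forall i j, y i j = (i == i0) && (j == j0)) ->
  (\sum_i \sum_j y i j = 1)%N.
Proof.
move=> hy; rewrite (bigD1 i0) //= [X in (_ + X)%N]big1 ?addn0 => [|i ne]; last first.
  by rewrite big1 // => j _; rewrite hy (negbTE ne).
rewrite (bigD1 j0) //= big1 ?addn0 => [|j ne]; first by rewrite hy !eqxx.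
by rewrite hy (negbTE ne) andbF.
Qed.

(** A sum of 0/1 terms equal to 1 has a true entry; once it is taken out, the other terms sum to 0
    and all vanish. *)
Lemma sum_eq1_choose m n (y : 'I_m -> 'I_n -> bool) :
  (\sum_i \sum_j y i j = 1)%N ->
  exists i0 j0, forall i j, y i j = (i == i0) && (j == j0).
Proof.
rewrite pair_big /=.
have [[i0 j0] /= y0 | none] := pickP (fun p : 'I_m * 'I_n => y p.1 p.2); last first.
  by rewrite big1 // => p _; rewrite none.
rewrite (bigD1 (i0, j0)) //= y0 => -[] /eqP; rewrite sum_nat_eq0 => /forallP h.
exists i0, j0 => i j; have := h (i, j); rewrite -pair_eqE /= /pair_eq /=.
have [/andP[/eqP-> /eqP->]|] := boolP ((i == i0) && (j == j0)); first by rewrite y0.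
by case: (y i j).
Qed.

Section Optimality.
Context (P : instance).

Definition part_data (n : 'I_(nN P)) : part :=
  (frac_of (part_span n), (frac_of (accesses n), (frac_of (threshold n),
   (omap (@nat_of_ord _) (cur_tier n), (omap (@nat_of_ord _) (cur_scheme n),
    [seq (frac_of (comp_ratio n k), frac_of (decomp_time n k))
    | k <- enum 'I_(nK P)]))))).

Lemma parts_instance : parts_of (instance_data P) = [seq part_data n | n <- enum 'I_(nN P)].
Proof. by []. Qed.

Definition option_ok n (l : 'I_(nL P)) (k : 'I_(nK P)) :=
  (if cur_scheme n is Some k0 then k == k0 else true)
  && (decomp_time n k + read_latency l <= threshold n).

Definition coef n (l : 'I_(nL P)) (k : 'I_(nK P)) :=
  (alpha P * storage_cost l + gamma P * change_cost (cur_tier n) l)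
    * (part_span n / comp_ratio n k)
  + beta P * accesses n
    * (compute_cost P * decomp_time n k
       + read_cost l * (part_span n / comp_ratio n k)).

Definition env n := (instance_data P, part_data n).

Lemma nth_tier_instance (l : 'I_(nL P)) : nth_tier (instance_data P) l =
  (frac_of (storage_cost l), (frac_of (read_cost l), (frac_of (read_latency l), tt))).
Proof. by rewrite /nth_tier /= nth_map_enum_ord. Qed.

Lemma nth_option_instance n (k : 'I_(nK P)) : nth_option (part_data n) k =
  (frac_of (comp_ratio n k), frac_of (decomp_time n k)).
Proof. by rewrite /nth_option /= nth_map_enum_ord. Qed.

Lemma change_instance n (l : 'I_(nL P)) :
  change_qf (new_of (instance_data P)) (change_of (instance_data P))
    (tier_of (part_data n)) l = frac_of (change_cost (cur_tier n) l).
Proof.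
by rewrite /change_qf /=; case: (cur_tier n) => [u|] /=; rewrite !nth_map_enum_ord.
Qed.

Lemma allowed_instance n (l : 'I_(nL P)) (k : 'I_(nK P)) : allowed (env n) (nat_of_ord l,
  nat_of_ord k) = option_ok n l k.
Proof.
rewrite /allowed nth_tier_instance nth_option_instance /=.
have [ed pd] := qval_frac_of (decomp_time_ge0 n k).
have [el pl] := qval_frac_of (read_latency_ge0 l).
have [et pt] := qval_frac_of (threshold_ge0 n).
have [ea pa] := qval_add pd pl.
rewrite (leq_qfE pa pt) ea ed el et /option_ok; congr andb.
by rewrite /scheme_ok; case: (cur_scheme n).
Qed.

Lemma cost_qf_instance n (l : 'I_(nL P)) (k : 'I_(nK P)) :
  let c := cost_qf (env n) (nat_of_ord l, nat_of_ord k) in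
  qval c = coef n l k /\ pos_den c.
Proof.
rewrite /cost_qf nth_tier_instance nth_option_instance change_instance /=.
have [er pr] := qval_frac_of (ltW (comp_ratio_gt0 n k)).
have [ei pi] : qval (inv_qf (frac_of (comp_ratio n k))) = (comp_ratio n k)^-1 /\
    pos_den (inv_qf (frac_of (comp_ratio n k))).
  by have := @qval_inv (frac_of (comp_ratio n k)); rewrite er; apply; apply: comp_ratio_gt0.
(* Value and positivity of the denominator travel together, as the arithmetic rules need both; the
   proof can then follow the shape of the cost expression. *)
have mulE p q a b : qval p = a /\ pos_den p -> qval q = b /\ pos_den q ->
    qval (mul_qf p q) = a * b /\ pos_den (mul_qf p q).
  by case=> <- hp [<- hq]; apply: qval_mul.
have addE p q a b : qval p = a /\ pos_den p -> qval q = b /\ pos_den q ->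
    qval (add_qf p q) = a + b /\ pos_den (add_qf p q).
  by case=> <- hp [<- hq]; apply: qval_add.
rewrite /coef; repeat lazymatch goal with
  | |- qval (add_qf _ _) = _ /\ _ => apply: (addE)
  | |- qval (mul_qf _ _) = _ /\ _ => apply: (mulE)
  | |- qval (inv_qf _) = _ /\ _ => by split
  | |- qval (frac_of _) = _ /\ _ => apply: qval_frac_of
  end.
all: first [exact: alpha_ge0|exact: beta_ge0|exact: gamma_ge0|exact: storage_cost_ge0
  |exact: change_cost_ge0|exact: part_span_ge0|exact: accesses_ge0|exact: compute_cost_ge0
  |exact: decomp_time_ge0|exact: read_cost_ge0].
Qed.

Lemma mem_candidates n c : c \in candidates (env n) ->
  exists (l : 'I_(nL P)) (k : 'I_(nK P)), c = (nat_of_ord l, nat_of_ord k) /\ option_ok n l k.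
Proof.
rewrite mem_filter => /andP[ok /flattenP[s /mapP[l]]].
rewrite mem_iota /= => ltl -> /mapP[k]; rewrite mem_iota /= => ltk e.
exists (Ordinal ltl), (Ordinal ltk); split=> //.
by rewrite -allowed_instance -e.
Qed.

Lemma candidates_mem n (l : 'I_(nL P)) (k : 'I_(nK P)) : option_ok n l k ->
  (nat_of_ord l, nat_of_ord k) \in candidates (env n).
Proof.
move=> ok; rewrite mem_filter allowed_instance ok /=.
apply/flattenP; exists [seq (nat_of_ord l, k) | k <- iota 0 (nK P)].
  by apply/mapP; exists (nat_of_ord l) => //; rewrite mem_iota /=.
by apply/mapP; exists (nat_of_ord k) => //; rewrite mem_iota /=.
Qed.

Lemma best_min n c0 : best (env n) = Some c0 ->
  forall c, c \in candidates (env n) ->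
    qval (cost_qf (env n) c0) <= qval (cost_qf (env n) c).
Proof.
(* Comparison of fractions is faithful for positive denominators, which are known for candidates;
   the induction on the list carries this property along. *)
have prop c : c \in candidates (env n) -> pos_den (cost_qf (env n) c).
  by case/mem_candidates => l [k [-> _]]; have [] := cost_qf_instance n l k.
rewrite /best; move: (candidates _) prop => s.
elim/last_ind: s c0 => // s c1 IH c0; rewrite -cats1 foldl_cat => prop.
have prop_s c : c \in s -> pos_den (cost_qf (env n) c).
  by move=> h; apply: prop; rewrite mem_cat h.
have {}IH c := IH c prop_s.
have mem := best_mem (env n) s.
case: (foldl _ None s) mem IH => [c2|] mem IH; last first.
  by case=> <- c; rewrite mem mem_seq1 => /eqP->.
have p2 : pos_den (cost_qf (env n) c2) by apply: prop; rewrite mem_cat mem.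
have p1 : pos_den (cost_qf (env n) c1) by apply: prop; rewrite mem_cat mem_seq1 eqxx orbT.
have {}IH c : c \in s -> qval (cost_qf (env n) c2) <= qval (cost_qf (env n) c).
  exact: IH.
rewrite /foldl /better leq_qfE //; case: ifP => [le|/negbT]; last rewrite -ltNge => lt.
  by case=> <- c; rewrite mem_cat mem_seq1 => /orP[/IH//|/eqP->].
case=> <- c; rewrite mem_cat mem_seq1 => /orP[/IH h|/eqP->//].
exact: le_trans (ltW lt) h.
Qed.

Lemma best_is_some n c0 : best (env n) = Some c0 ->
  exists l0 k0, [/\ forall (l : 'I_(nL P)) (k : 'I_(nK P)),
      is_choice (best (env n)) l k = (l == l0) && (k == k0),
    option_ok n l0 k0 & forall l k, option_ok n l k -> coef n l0 k0 <= coef n l k].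
Proof.
move=> e; have := best_mem (env n) (candidates (env n)); rewrite -/(best _) e.
case/mem_candidates => l0 [k0 [ec ok]]; exists l0, k0; split=> //.
  by move=> l k; rewrite ec.
move=> l k /candidates_mem/(best_min e).
rewrite ec.
by have [-> _] := cost_qf_instance n l0 k0; have [-> _] := cost_qf_instance n l k.
Qed.

Lemma best_is_none n : best (env n) = None -> forall l k, ~~ option_ok n l k.
Proof.
move=> e l k; apply/negP => /candidates_mem.
by have := best_mem (env n) (candidates (env n)); rewrite -/(best _) e => ->.
Qed.

(** Each partition gets exactly one pair, so the latency sum collapses to a single term and both
    remaining constraints on the partition become admissibility of that pair. *)
Lemma feasible_choose (y : assignment P) n : feasible y ->
  exists l0 k0, (forall l k, y n l k = (l == l0) && (k == k0)) /\ option_ok n l0 k0.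
Proof.
case=> /(_ n)/sum_eq1_choose[l0 [k0 h]] _ /(_ n) lat sch.
exists l0, k0; split=> //; apply/andP; split.
  have := cur_scheme_existing n; case e: (cur_scheme n) => [k1|] //= /esym lt.
  apply/eqP; have := sch n l0 k0 lt; rewrite h !eqxx e => hh.
  by apply/eqP; apply: contraT => /eqP ne; case: hh => // -[].
by rewrite (sum_choose (fun l k => decomp_time n k + read_latency l) h) in lat.
Qed.

Lemma costE (y : assignment P) :
  cost y = \sum_n \sum_l \sum_k coef n l k * (y n l k)%:R.
Proof. by apply: eq_bigr => n _; rewrite exchange_big. Qed.

Definition best_assignment : assignment P := fun n l k => is_choice (best (env n)) l k.

Definition best_answer : option (assignment P) :=
  if [forall n, best (env n) != None] then Some best_assignment else None.

Lemma best_answer_correct : no_capacity_constraints P -> correct_answer best_answer.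
Proof.
move=> cap; rewrite /best_answer; case: forallP => [h|h] /=; last first.
  (* A partition without a best pair has no admissible pair at all, whereas a feasible assignment
     would provide one. *)
  move=> y fy; apply: h => n; apply/eqP => e.
  have [l0 [k0 [_ ok]]] := feasible_choose n fy.
  by have := best_is_none e l0 k0; rewrite ok.
have {}h n : exists l0 k0, [/\ forall l k,
      best_assignment n l k = (l == l0) && (k == k0),
    option_ok n l0 k0 & forall l k, option_ok n l k -> coef n l0 k0 <= coef n l k].
  by have := h n; case e: (best (env n)) => [c|] // _; apply: best_is_some e.
split.
  split=> [n|l|n|n l k lt].
  - by have [l0 [k0 [hx _ _]]] := h n; apply: sum_choose_nat hx.
  - by rewrite cap leey.
  - have [l0 [k0 [hx /andP[_ ok] _]]] := h n.
    by rewrite (sum_choose (fun l k => decomp_time n k + read_latency l) hx).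
  - have [l0 [k0 [hx /andP[ok _] _]]] := h n; rewrite hx => ne.
    apply/negbTE/negP => /andP[_ /eqP ek]; apply: ne; rewrite ek.
    have := cur_scheme_existing n; rewrite lt.
    by case: (cur_scheme n) ok => //= k1 /eqP ->.
(* The costs are compared partition by partition: each inner double sum collapses to the coefficient
   of the chosen pair. *)
move=> y fy; rewrite !costE; apply: ler_sum => n _.
have [l0 [k0 [hx _ min]]] := h n; have [l1 [k1 [hy ok]]] := feasible_choose n fy.
by rewrite (sum_choose (coef n) hx) (sum_choose (coef n) hy); apply: min.
Qed.

(** The algorithm enumerates naturals and the encoding ordinals; [val_enum_ord] identifies the two
    lists. *)
Lemma choice_row_instance n : choice_row (instance_data P) (part_data n) =
  enc_table (fun l => enc_table (fun k => [:: best_assignment n l k])).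
Proof.
rewrite /choice_row /enc_table -[dim_L _]/(nL P) -[dim_K _]/(nK P) -!val_enum_ord -map_comp.
congr flatten; apply: eq_map => l /=; rewrite flatten_map1 -map_comp.
by apply: eq_map.
Qed.

Lemma answer_instance : answer (instance_data P) = enc_answer best_answer.
Proof.
rewrite /answer parts_instance all_map /best_answer.
have -> : all (preim part_data (fun p => isSome (best (instance_data P, p)))) (enum 'I_(nN P))
        = [forall n, best (env n) != None].
  apply/allP/forallP => h n; last by have := h n; rewrite /env /=; case: (best _).
  by have := h n; rewrite mem_enum /env /= => /(_ isT); case: (best _).
case: ifP => _ //=; congr cons; rewrite -map_comp /enc_table; congr flatten.
by apply: eq_map => n /=; rewrite choice_row_instance.
Qed.

End Optimality.

Lemma solve_correct P : no_capacity_constraints P ->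
  exists2 a : option (assignment P), correct_answer a & solve (enc_instance P) = enc_answer a.
Proof.
move=> cap; exists (best_answer P); first exact: best_answer_correct.
by rewrite /solve read_enc_instance // answer_instance.
Qed.

Local Close Scope ring_scope.

(** * Input and output *)

Definition reverse_step := branch (peek 0 isSome)
  (branch (pop 0 is_true_top) (push 1 true) (push 1 false)) (peek 0 no).

(** Symbols are pushed last to first: a bit is [true false false] or [false], and the tag [true] of
    the list cell comes on top. *)
Definition encode_step := branch (peek 1 isSome)
  (branch (pop 1 is_true_top)
    (seqf (push 3 false) (seqf (push 3 false) (seqf (push 3 true) (push 3 true))))
    (seqf (push 3 false) (push 3 true)))
  (peek 1 no).

(** Lists grow by prepending, so the input is used from its end: it is first reversed onto tape 1.
    The symbol [false] pushed in between is the empty list. *)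
Definition encode_input :=
  seqf (loop reverse_step) (seqf (push 3 false) (loop encode_step)).

Lemma ex_reverse (w u : seq bool) :
  ex (loop reverse_step) [:: w; u; [::]; [::]] (20 * size w + 5) false
     [:: [::]; catrev w u; [::]; [::]].
Proof.
elim: w u => [|x w IH] u.
  by eapply ex_conv; [apply: ex_loop_exit; ex_then; ex_prim|..].
have e : ex reverse_step [:: x :: w; u; [::]; [::]] 8 true [:: w; x :: u; [::]; [::]].
  by case: x; (eapply ex_conv; [do 2 ex_then; ex_prim|..]).
by eapply ex_conv; [apply: ex_loop_next e (IH _)|rewrite /=; lia|..].
Qed.

Lemma ex_encode (w u : seq bool) :
  ex (loop encode_step) [:: [::]; w; [::]; ew u] (30 * size w + 5) false
     [:: [::]; [::]; [::]; ew (catrev w u)].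
Proof.
elim: w u => [|x w IH] u.
  by eapply ex_conv; [apply: ex_loop_exit; ex_then; ex_prim|..].
have e : ex encode_step [:: [::]; x :: w; [::]; ew u] 25 true [:: [::]; w; [::]; ew (x :: u)].
  by case: x; (eapply ex_conv; [do 5? ex_then; ex_prim|..]).
by eapply ex_conv; [apply: ex_loop_next e (IH _)|rewrite /=; lia|..].
Qed.

Lemma ex_encode_input (w : seq bool) :
  ex encode_input [:: w; [::]; [::]; [::]] (50 * size w + 20) false
     [:: [::]; [::]; [::]; ew w].
Proof.
eapply ex_conv.
- eapply ex_seq; first exact: ex_reverse.
  by ex_then; exact: (@ex_encode (catrev w [::]) [::]).
- by rewrite catrevE size_cat size_rev /=; lia.
- by [].
- by rewrite catrev_catrev cats0.
Qed.

Definition decode_step := branch (pop 3 is_true_top)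
  (branch (pop 3 is_true_top) (seqf (pop 3 no) (seqf (pop 3 no) (push 1 true)))
                              (push 1 false))
  (peek 3 no).

(** Pouring tape 1 back restores the order and puts the word on the last tape, where the output is
    read. *)
Definition decode_output := seqf (loop decode_step) (dump 1).

Lemma ex_decode (w u : seq bool) :
  ex (loop decode_step) [:: [::]; u; [::]; ew w] (20 * size w + 5) false
     [:: [::]; catrev w u; [::]; [::]].
Proof.
elim: w u => [|x w IH] u.
  by eapply ex_conv; [apply: ex_loop_exit; ex_then; ex_prim|..].
have e : ex decode_step [:: [::]; u; [::]; ew (x :: w)] 15 true [:: [::]; x :: u; [::]; ew w].
  by case: x; (eapply ex_conv; [do 4? ex_then; ex_prim|..]).
by eapply ex_conv; [apply: ex_loop_next e (IH _)|rewrite /=; lia|..].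
Qed.

Lemma ex_decode_output (w : seq bool) :
  ex decode_output [:: [::]; [::]; [::]; ew w] (40 * size w + 20) false
     [:: [::]; [::]; [::]; w].
Proof.
eapply ex_conv.
- by eapply ex_seq; [exact: ex_decode|exact: ex_dump_snd].
- by rewrite catrevE size_cat size_rev /=; lia.
- by [].
- by rewrite catrev_catrev cats0.
Qed.

Lemma polytime_machine (f : seq bool -> seq bool) : polytime f ->
  exists F d, forall w, exists b,
    ex F [:: w; [::]; [::]; [::]] ((size w).+2 ^ d) b [:: [::]; [::]; [::]; f w].
Proof.
case=> F [d hF].
(* An input of length [n] has an encoding of size at most [4 * n + 1]. The power that bounds the
   time of [F] also bounds the size of its value, hence the time of decoding. *)
pose T n := (50 * n + 20 + ((4 * n + 1).+2 ^ d + (40 * (4 * n + 1).+2 ^ d + 20)).+1).+1.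
have [e he] : poly_bounded T by rewrite /T; pb.
exists (seqf encode_input (seqf F decode_output)), e => w.
have [/(_ [::])[b hb] le] := hF w; rewrite !cats0 in hb.
exists false; apply: ex_mono (he _) _.
apply: ex_mono (_ : _ <= T (size w)) _; last first.
  by eapply ex_seq; [exact: ex_encode_input|eapply ex_seq; [exact: hb|exact: ex_decode_output]].
have : (sz w).+2 ^ d <= (4 * size w + 1).+2 ^ d by apply: leq_pow2; apply: sz_word.
have : size (f w) <= (sz w).+2 ^ d by apply: leq_trans (size_word_sz _) le.
by rewrite /T; lia.
Qed.

Lemma is_stack_input w : is_stack (tape_of_seq (map Some w)) w.
Proof. by split=> //; case: w => [|b w]; [exists 1|exists 0; rewrite /= cats0]. Qed.

Lemma is_stack_word t w : is_stack t w -> tape_word t = w.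
Proof.
case=> _ [k e]; rewrite /tape_word e; elim: w {e} => [|b w IH] /=; last by rewrite IH.
by case: k.
Qed.

Lemma ex_outputs F w n b s :
  ex F [:: w; [::]; [::]; [::]] n b s -> outputs_within (frag_TM F) w n (nth [::] s 3).
Proof.
move=> h.
have init : stacks_in (ctapes (init_config (frag_TM F) w)) [:: w; [::]; [::]; [::]].
  by case=> [[|[|[|[|//]]]]] i /=; [exact: is_stack_input|..]; exact: (is_stack_input [::]).
have [t [q qb e] st] := h _ init.
rewrite /outputs_within -[init_config _ _]/(fcfg (fstart F) _).
rewrite -/(@fstep F) e /= qb; split=> //.
exact: is_stack_word (st ord_max).
Qed.

Lemma horner_pow_nat d n : (('X + 2%:P) ^+ d : {poly nat})%R.[n]%R = n.+2 ^ d.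
Proof. by rewrite horner_exp hornerD hornerX hornerC natrXE natrDE addn2. Qed.

Theorem theorem3 :
  exists (M : TM) (p : {poly nat}),
    forall P : instance, no_capacity_constraints P ->
      exists a : option (assignment P),
        correct_answer a /\
        outputs_within M (enc_instance P) (horner p (size (enc_instance P)))
          (enc_answer a).
Proof.
have [F [d h]] := polytime_machine polytime_solve.
exists (frag_TM F), (('X + 2%:P) ^+ d)%R => P cap.
have [a ok e] := solve_correct cap; exists a; split=> //.
have [b hb] := h (enc_instance P).
by rewrite horner_pow_nat -e; apply: ex_outputs hb.
Qed.
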